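(* We have the generating function $$\tilde B_{n+1}^{CFC}(q)=D_{n+2}^{CFC}(q)+\frac{2^{n+1}}{1-q^{2(n+1)}}\,q^{2(n+1)}+\frac{2(n+1)}{1-q^{2n+1}}\,q^{2n+1}.$$ Furthermore, the coefficients of $\tilde B_{n+1}^{CFC}(q)$ are ultimately periodic of exact period $2(n+1)(2n+1)$, and the periodicity starts at length $n+2$.
   Context: $\tilde B_{n+1}$ (with $n\ge 2$) is the affine Coxeter group with generators $t_1,t_2,s_1,\dots,s_{n-1},u$ whose Coxeter diagram has edges $t_1-s_1$, $t_2-s_1$, $s_i-s_{i+1}$ ($1\le i\le n-2$), all with $m=3$, and $s_{n-1}-u$ with $m=4$. $D_{n+2}$ is the finite Coxeter group with generators $t_1,t_2,s_1,\dots,s_n$ whose diagram has edges $t_1-s_1$, $t_2-s_1$, $s_i-s_{i+1}$ ($1\le i\le n-1$), all with $m=3$. For a Coxeter group $W$ with length $\ell$, an element is fully commutative (FC) if any two of its reduced expressions are related by a sequence of transpositions of adjacent commuting generators. A cyclic shift of a word $s_{i_1}\cdots s_{i_k}$ is any word $s_{i_j}\cdots s_{i_k}s_{i_1}\cdots s_{i_{j-1}}$. An element is cyclically fully commutative (CFC) if every cyclic shift of every one of its reduced expressions is a reduced expression of an FC element. $W^{CFC}$ is the set of CFC elements, and $W^{CFC}(q)=\sum_{w\in W^{CFC}}q^{\ell(w)}$ (a formal power series). A sequence $(a_k)_{k\ge0}$ is ultimately periodic of exact period $N$ with periodicity starting at length $L$ if $a_{k+N}=a_k$ for all $k\ge L$,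 $N$ is the least positive integer that is an eventual period, and $L$ is the least integer with this property.
   Formalization: The periodicity is stated to start at length n+3 instead of n+2: the coefficient at length n+2 is 2^{n+1} (Coxeter elements), while one period later it is 0, so n+2 is false for every n ≥ 2. *)

(* Defs.v *)
From HB Require Import structures.
From mathcomp Require Import all_boot all_order all_algebra finmap.
From mathcomp Require Import boolp classical_sets functions cardinality.
From Stdlib Require Import Relation_Operators.

Set Implicit Arguments.
Unset Strict Implicit.
Unset Printing Implicit Defensive.

Local Open Scope quotient_scope.

(* The value 0 of a Coxeter matrix stands for infinity: the relation
   (s t)^0 = 1 imposes nothing. *)
Record coxMatrix (S : finType) := CoxMatrix {
  cox_m :> S -> S -> nat;
  cox_m_diag : forall s t, (cox_m s t == 1) = (s == t);
  cox_m_sym : forall s t, cox_m s t = cox_m t s }.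

Section CoxeterGroup.
Variables (S : finType) (M : coxMatrix S).

(* The defining relations (s t)^(M s t) = 1, applied inside a word; for s = t
   this is s s = 1. *)
Inductive cox_step : seq S -> seq S -> Prop :=
  CoxStep u v s t :
    cox_step (u ++ flatten (nseq (M s t) [:: s; t]) ++ v) (u ++ v).

Definition cox_equiv : rel (seq S) :=
  fun x y => `[< clos_refl_sym_trans _ cox_step x y >].

Lemma cox_equiv_refl : reflexive cox_equiv.
Proof. by move=> x; apply/asboolP; apply: rst_refl. Qed.

Lemma cox_equiv_sym : symmetric cox_equiv.
Proof. by move=> x y; apply/asboolP/asboolP; apply: rst_sym. Qed.

Lemma cox_equiv_trans : transitive cox_equiv.
Proof.
by move=> y x z /asboolP xy /asboolP yz; apply/asboolP; apply: rst_trans xy yz.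
Qed.

Canonical cox_equiv_equiv :=
  EquivRel cox_equiv cox_equiv_refl cox_equiv_sym cox_equiv_trans.

Definition coxGroup := {eq_quot cox_equiv}.

HB.instance Definition _ := Choice.on coxGroup.
HB.instance Definition _ := EqQuotient.on coxGroup.

Lemma cox_step_cat a b x y :
  cox_step x y -> cox_step (a ++ x ++ b) (a ++ y ++ b).
Proof. by case=> u v s t; rewrite -!catA !(catA a); apply: CoxStep. Qed.

Lemma cox_equiv_ctx a b x y :
  cox_equiv x y -> cox_equiv (a ++ x ++ b) (a ++ y ++ b).
Proof.
move=> /asboolP xy; apply/asboolP; elim: xy => {x y} [x y xy|x|x y _|x y z _ xy _].
- exact/rst_step/cox_step_cat.
- exact: rst_refl.
- exact: rst_sym.
- exact: rst_trans xy.
Qed.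

Lemma cox_equiv_cat x x' y y' :
  cox_equiv x x' -> cox_equiv y y' -> cox_equiv (x ++ y) (x' ++ y').
Proof.
move=> xx' yy'; apply: (@cox_equiv_trans (x' ++ y)).
  exact: (cox_equiv_ctx [::] y xx').
by have := cox_equiv_ctx x' [::] yy'; rewrite !cats0.
Qed.

Lemma cox_equiv_revl x : cox_equiv (rev x ++ x) [::].
Proof.
elim: x => [|s x IHx]; first exact: cox_equiv_refl.
apply: cox_equiv_trans IHx; apply/asboolP; apply: rst_step.
have Mss : M s s = 1 by apply/eqP; rewrite cox_m_diag.
by have := CoxStep (rev x) x s s; rewrite Mss rev_cons cat_rcons.
Qed.

Lemma cox_equiv_revr x : cox_equiv (x ++ rev x) [::].
Proof. by rewrite -{1}(revK x) cox_equiv_revl. Qed.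

Definition cox_one : coxGroup := \pi_coxGroup [::].
Definition cox_mul (x y : coxGroup) : coxGroup :=
  \pi_coxGroup (repr x ++ repr y).
Definition cox_inv (x : coxGroup) : coxGroup := \pi_coxGroup (rev (repr x)).

Lemma cox_piP x y : reflect (\pi_coxGroup x = \pi_coxGroup y) (cox_equiv x y).
Proof. exact: eqmodP. Qed.

Lemma cox_repr_pi x : cox_equiv (repr (\pi_coxGroup x)) x.
Proof. by apply/cox_piP; rewrite reprK. Qed.

Lemma cox_mul_pi x y :
  cox_mul (\pi_coxGroup x) (\pi_coxGroup y) = \pi_coxGroup (x ++ y).
Proof. by apply/cox_piP/cox_equiv_cat; apply: cox_repr_pi. Qed.

Lemma cox_mulA : associative cox_mul.
Proof.
elim/quotW=> x; elim/quotW=> y; elim/quotW=> z.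
by rewrite (cox_mul_pi y z) (cox_mul_pi x y) !cox_mul_pi catA.
Qed.

Lemma cox_mul1 : left_id cox_one cox_mul.
Proof. by elim/quotW=> x; rewrite cox_mul_pi. Qed.

Lemma cox_mulr1 : right_id cox_one cox_mul.
Proof. by elim/quotW=> x; rewrite cox_mul_pi cats0. Qed.

Lemma cox_mulV : left_inverse cox_one cox_inv cox_mul.
Proof.
move=> x; rewrite -{2}[x]reprK cox_mul_pi.
exact/cox_piP/cox_equiv_revl.
Qed.

Lemma cox_mulrV : right_inverse cox_one cox_inv cox_mul.
Proof.
move=> x; rewrite -{1}[x]reprK cox_mul_pi.
exact/cox_piP/cox_equiv_revr.
Qed.

HB.instance Definition _ := isGroup.Build coxGroup
  cox_mulA cox_mul1 cox_mulr1 cox_mulV cox_mulrV.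

Definition cox_gen (s : S) : coxGroup := \pi_coxGroup [:: s].

Definition cox_prod (x : seq S) : coxGroup :=
  (\big[*%g/1%g]_(s <- x) cox_gen s)%g.

Lemma cox_prodE x : cox_prod x = \pi_coxGroup x.
Proof.
rewrite /cox_prod; elim: x => [|s x IHx]; first by rewrite big_nil.
by rewrite big_cons IHx [LHS]cox_mul_pi.
Qed.

Lemma cox_prod_surj (w : coxGroup) :
  exists k, `[< exists x, size x = k /\ cox_prod x = w >].
Proof.
exists (size (repr w)); apply/asboolP; exists (repr w).
by rewrite cox_prodE reprK.
Qed.

Definition cox_length (w : coxGroup) : nat := ex_minn (cox_prod_surj w).

Definition reduced (x : seq S) : Prop := cox_length (cox_prod x) = size x.

Definition reduced_expr (w : coxGroup) (x : seq S) : Prop :=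
  cox_prod x = w /\ reduced x.

Inductive commutation_step : seq S -> seq S -> Prop :=
  CommutationStep u v s t of M s t = 2 :
    commutation_step (u ++ [:: s, t & v]) (u ++ [:: t, s & v]).

Definition fully_commutative (w : coxGroup) : Prop :=
  forall x y, reduced_expr w x -> reduced_expr w y ->
    clos_refl_trans _ commutation_step x y.

Definition cyclically_fully_commutative (w : coxGroup) : Prop :=
  forall x i, reduced_expr w x ->
    reduced (rot i x) /\ fully_commutative (cox_prod (rot i x)).

Definition CFC_of_length (k : nat) : set coxGroup :=
  [set w | cyclically_fully_commutative w /\ cox_length w = k]%classic.

(* This makes the cardinal [#|` fset_set (CFC_of_length k)|] meaningful. *)
Lemma finite_CFC_of_length k : finite_set (CFC_of_length k).
Proof.
apply: (@sub_finite_set _ _ (range (fun x : k.-tuple S => cox_prod x))).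
  move=> w [_]; rewrite /cox_length; case: ex_minnP => m /asboolP[x [xm xw]] _ mk.
  have xk : size x == k by rewrite xm mk.
  by exists (Tuple xk).
exact/finite_image/finite_finset.
Qed.

End CoxeterGroup.

Arguments CFC_of_length {S} M k.

(* The node t_1 (resp. t_2) is [inl true] (resp. [inl false]), and the nodes of
   the chain hanging from t_1 and t_2 are [inr 0], ..., [inr (n - 1)].  The
   chain is s_1, ..., s_n for D_(n+2) and s_1, ..., s_(n-1), u for the affine
   B_(n+1). *)
Definition fork (n : nat) : finType := (bool + 'I_n)%type.

Definition fork_edge n (x y : fork n) : bool :=
  match x, y with
  | inl _, inl _ => false
  | inl _, inr i | inr i, inl _ => i == 0 :> nat
  | inr i, inr j => (i.+1 == j :> nat) || (j.+1 == i :> nat)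
  end.

Definition fork_end n (x : fork n) : bool :=
  if x is inr i then i.+1 == n else false.

Lemma fork_edge_sym n : symmetric (@fork_edge n).
Proof. by move=> [a|i] [b|j] //=; rewrite orbC. Qed.

Definition D_m n (x y : fork n) : nat :=
  if x == y then 1 else if fork_edge x y then 3 else 2.

Definition affB_m n (x y : fork n) : nat :=
  if x == y then 1 else
  if fork_edge x y then (if fork_end x || fork_end y then 4 else 3) else 2.

Lemma D_m_diag n (x y : fork n) : (D_m x y == 1) = (x == y).
Proof. by rewrite /D_m; case: (x == y) => //; case: ifP. Qed.

Lemma D_m_sym n (x y : fork n) : D_m x y = D_m y x.
Proof. by rewrite /D_m eq_sym fork_edge_sym. Qed.

Lemma affB_m_diag n (x y : fork n) : (affB_m x y == 1) = (x == y).
Proof. by rewrite /affB_m; case: (x == y) => //; do 2?case: ifP. Qed.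

Lemma affB_m_sym n (x y : fork n) : affB_m x y = affB_m y x.
Proof. by rewrite /affB_m eq_sym fork_edge_sym orbC. Qed.

(* The matrix of D_(n+2), with n + 2 generators. *)
Definition D_matrix n : coxMatrix (fork n) :=
  CoxMatrix (@D_m_diag n) (@D_m_sym n).

(* The matrix of the affine B_(n+1), with n + 2 generators; for n = 1 the end
   node u would be attached to t_1 and t_2, so this needs n >= 2. *)
Definition affB_matrix n : coxMatrix (fork n) :=
  CoxMatrix (@affB_m_diag n) (@affB_m_sym n).

Import GRing.Theory.
Local Open Scope ring_scope.

(* Formal power series.  The type is an alias of [nat -> R] whose product is
   the Cauchy product and not the pointwise one. *)
Definition fps (R : comNzRingType) : Type := nat -> R.

Section FormalPowerSeries.
Variable R : comNzRingType.
Implicit Types a b c : fps R.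

HB.instance Definition _ := GRing.Zmodule.copy (fps R) (nat -> R).

Definition fps_one : fps R := fun k => (k == 0)%N%:R.
Definition fps_mul a b : fps R := fun k => \sum_(i < k.+1) a i * b (k - i)%N.
Definition fps_X : fps R := fun k => (k == 1)%N%:R.

Let trunc N a : {poly R} := \poly_(i < N) a i.

Let trunc_coef N a k : (k < N)%N -> (trunc N a)`_k = a k.
Proof. by move=> kN; rewrite coef_poly kN. Qed.

Let trunc_mul N a b k : (k < N)%N ->
  (trunc N a * trunc N b)`_k = fps_mul a b k.
Proof.
move=> kN; rewrite coefM; apply: eq_bigr => i _.
rewrite !trunc_coef //; first exact: leq_ltn_trans (leq_subr _ _) kN.
by apply: leq_ltn_trans kN; rewrite -ltnS.
Qed.

Lemma fps_mulC : commutative fps_mul.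
Proof.
move=> a b; apply/funext => k.
by rewrite -!(@trunc_mul k.+1) // mulrC.
Qed.

Lemma fps_mulA : associative fps_mul.
Proof.
move=> a b c; apply/funext => k.
pose T := trunc k.+1.
have -> : fps_mul a (fps_mul b c) k = (T a * (T b * T c))`_k.
  rewrite coefM; apply: eq_bigr => i _; rewrite trunc_coef // trunc_mul //.
  by rewrite ltnS leq_subr.
rewrite mulrA coefM; apply: eq_bigr => i _.
by rewrite trunc_mul // trunc_coef // ltnS leq_subr.
Qed.

Lemma fps_mul1 : left_id fps_one fps_mul.
Proof.
move=> a; apply/funext => k; rewrite /fps_mul big_ord_recl /fps_one /= mul1r.
by rewrite subn0 big1 ?addr0 // => i _; rewrite mul0r.
Qed.

Lemma fps_mulDl : left_distributive fps_mul +%R.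
Proof.
move=> a b c; apply/funext => k; rewrite /fps_mul /=.
rewrite [RHS](_ : _ = fps_mul a c k + fps_mul b c k) // /fps_mul -big_split /=.
by apply: eq_bigr => i _; rewrite -mulrDl.
Qed.

Lemma fps_oner_neq0 : fps_one != 0.
Proof.
by apply/eqP => /(congr1 (fun f : fps R => f 0%N))/eqP; rewrite /fps_one oner_eq0.
Qed.

HB.instance Definition _ := GRing.Zmodule_isComNzRing.Build (fps R)
  fps_mulA fps_mulC fps_mul1 fps_mulDl fps_oner_neq0.

Definition fps_unit : pred (fps R) := fun a => `[< exists b, b * a = 1 >].
Definition fps_inv a : fps R := xget a [set b | b * a = 1]%classic.

Lemma fps_mulVx : {in fps_unit, left_inverse 1 fps_inv *%R}.
Proof.
by move=> a /asboolP[b ba]; rewrite /fps_inv; case: xgetP => [c _ //|/(_ b)].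
Qed.

Lemma fps_unitPl a b : b * a = 1 -> fps_unit a.
Proof. by move=> ba; apply/asboolP; exists b. Qed.

Lemma fps_inv_out : {in [predC fps_unit], fps_inv =1 id}.
Proof.
move=> a ua; apply: xgetPN => b /fps_unitPl aU.
by rewrite !inE [_ \in _]aU in ua.
Qed.

HB.instance Definition _ := GRing.ComNzRing_hasMulInverse.Build (fps R)
  fps_mulVx fps_unitPl fps_inv_out.

Definition fps_coef a (k : nat) : R := a k.

End FormalPowerSeries.

Notation "'q" := (fps_X int) (at level 0) : ring_scope.

Definition CFC_series (S : finType) (M : coxMatrix S) : fps int :=
  fun k => #|` fset_set (CFC_of_length M k)|%:R.

Definition periodic_from (T : Type) (a : nat -> T) (N L : nat) : Prop :=
  forall k, (L <= k)%N -> a (k + N)%N = a k.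

Definition eventual_period (T : Type) (a : nat -> T) (N : nat) : Prop :=
  (0 < N)%N /\ exists L, periodic_from a N L.

(* For the affine B_(n+1) the least such L is n + 3, one more than the degree of
   the D_(n+2) polynomial: the coefficient of q^(n+2) is 2^(n+1), counting the
   Coxeter elements, while n + 2 is a multiple of neither 2(n+1) nor 2n+1, so
   the coefficient at n + 2 plus the period is 0. *)
Definition exact_period_from (T : Type) (a : nat -> T) (N L : nat) : Prop :=
  [/\ eventual_period a N,
      forall N', eventual_period a N' -> (N <= N')%N,
      periodic_from a N L
    & forall L', periodic_from a N L' -> (L <= L')%N].

(* Main.v *)
Require Import Defs.
From mathcomp Require Import all_boot all_order all_algebra finmap zify ring.
From mathcomp Require Import boolp classical_sets functions cardinality.
From Stdlib Require Import Relation_Operators.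

(** An element is fully commutative exactly when the words obtained by
    commutations from one of its reduced expressions contain neither a square
    [s s] nor an alternating word of length [M s t > 2] in two letters; words
    with this property are reduced ([fully_commutative_braid_free],
    [braid_free_reduced]).  The direction from words to elements rests on the
    exchange property, which holds for the group defined by the presentation
    because the reflections met along a word, counted modulo 2, only depend on
    its product, and on the fact that [s t] has order exactly [M s t].  The
    cyclically fully commutative elements of length [k] are therefore the
    commutation classes of the words of size [k] all of whose cyclic shifts have
    the property ([CFC_of_lengthP], [cfc_word_prod_eq]), and such a class is
    determined by the projections of a word to the pairs of letters that do not
    commute.

    In such a cyclic word, two consecutive occurrences of a letter [s] are
    separated by at least two letters that do not commute with [s], if all the
    edges at [s] have label 3; otherwise [s s] or [s t s] would appear.  Along
    the fork, with the two tips together as level 0, the numbers [c_i] of letters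
    of level [i] thus satisfy [2 c_i <= c_(i-1) + c_(i+1)] when [c_i > 1], and
    do not decrease from there on.  In [D_(n+2)] they would keep
    growing beyond the last node, so no letter is repeated ([D_uniq]).  In the affine group the only exception
    is the node [v] before the edge labelled 4, where a gap can consist of a
    single [u].  Each such gap has to be compensated by an adjacent gap without
    [u], and together with the inequality [c_(n-2) <= c_(n-1)] this leaves two
    possibilities ([gap_cycle]); all the inequalities are then equalities, and
    the pattern of the gaps of [v] propagates down to the tips
    ([affB_families]).  Either any two adjacent levels alternate around the
    cycle, the two tips sharing level 0 and alternating as well, or the word
    zigzags along the fork, back and forth.

    The words without repetition and their commutation classes are the same for
    both groups.  An alternating class of length [2 (n + 1) k] is given by the
    level that comes first on each of the [n] edges of the path of levels, and
    by the tip that comes first: [2 ^ (n + 1)] choices.  A zigzag class of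
    length [(2 n + 1) k] is a cut of the periodic walk; there are [2 n + 1]
    cuts, and the one between the two tips counts twice because the tips no
    longer commute past each other there: [2 (n + 1)] choices.  Exactness of the
    period holds because only the common multiples of the coprime numbers
    [2 n + 2] and [2 n + 1] receive both contributions. *)

Set Implicit Arguments.
Unset Strict Implicit.
Unset Printing Implicit Defensive.

(** * The exchange property *)

Section Exchange.
Variables (S : finType) (M : coxMatrix S).
Local Notation gen := (cox_gen M).
Local Notation prod := (cox_prod M).
Local Open Scope group_scope.
Implicit Types (s t : S) (x y u v : seq S) (r : coxGroup M).

Lemma cox_prod_nil : prod [::] = 1.
Proof. by rewrite /cox_prod big_nil. Qed.

Lemma cox_prod_cons s x : prod (s :: x) = gen s * prod x.
Proof. by rewrite /cox_prod big_cons. Qed.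

Lemma cox_prod_cat x y : prod (x ++ y) = prod x * prod y.
Proof. by rewrite /cox_prod big_cat. Qed.

Lemma cox_prod_eqP x y : prod x = prod y <-> cox_equiv M x y.
Proof. by rewrite !cox_prodE; split=> [/cox_piP|/cox_piP]. Qed.

Lemma cox_prod_relator s t : prod (flatten (nseq (M s t) [:: s; t])) = 1.
Proof.
rewrite -cox_prod_nil; apply/cox_prod_eqP/asboolP; apply: rst_step.
by have := CoxStep M [::] [::] s t; rewrite /= cats0.
Qed.

Lemma cox_genK s : gen s * gen s = 1.
Proof.
have := cox_prod_relator s s; rewrite (eqP (_ : M s s == 1%N)); last first.
  by rewrite cox_m_diag.
by rewrite /= !cox_prod_cons cox_prod_nil mulg1.
Qed.

Lemma cox_genV s : (gen s)^-1 = gen s.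
Proof. by apply: mulg1_eq; apply: cox_genK. Qed.

Lemma cox_genKl s : cancel ( *%g (gen s)) ( *%g (gen s)).
Proof. by move=> w; rewrite mulgA cox_genK mul1g. Qed.

(** The parity of the number of positions [i] of [x = s_1 ... s_k] with
    [s_1 ... s_(i-1) s_i s_(i-1) ... s_1 = r].  In geometric terms it tells
    whether the wall of [r] separates the chambers of 1 and of the product. *)
Fixpoint crossings x r : bool :=
  if x is s :: x' then (r == gen s) (+) crossings x' (r ^ gen s) else false.

Lemma crossings_cat x y r :
  crossings (x ++ y) r = crossings x r (+) crossings y (r ^ prod x).
Proof.
elim: x r => [|s x IHx] r /=; first by rewrite cox_prod_nil conjg1.
by rewrite IHx cox_prod_cons conjgM addbA.
Qed.

Fixpoint alt (m : nat) s t : seq S :=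
  if m is m'.+1 then s :: alt m' t s else [::].

Lemma size_alt m s t : size (alt m s t) = m.
Proof. by elim: m s t => //= m IHm s t; rewrite IHm. Qed.

Lemma alt_double m s t : alt (m + m) s t = flatten (nseq m [:: s; t]).
Proof. by elim: m => //= m IHm; rewrite addnS /= IHm. Qed.

(** The reflections met along [s t s t ...] are [s], [s t s], [s t s t s] and so
    on, and the one met at position [i] is [(s t)^i s]. *)
Lemma crossings_alt m s t r :
  crossings (alt m s t) r
    = \big[addb/false]_(i < m) (r == (gen s * gen t) ^+ i * gen s).
Proof.
elim: m s t r => [|m IHm] s t r /=; first by rewrite big_ord0.
rewrite big_ord_recl /= mul1g IHm; congr (_ (+) _); apply: eq_bigr => i _.
have gstt k : (gen t * gen s) ^+ k * gen t = gen t * (gen s * gen t) ^+ k.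
  elim: k => [|k IHk]; first by rewrite !expg0 mul1g mulg1.
  by rewrite !expgSr !mulgA -IHk -!mulgA.
rewrite /bump /= add1n expgS gstt conjgE cox_genV.
rewrite -(inj_eq (mulgI (gen s))) cox_genKl -(inj_eq (mulIg (gen s))).
by rewrite -[X in X == _]mulgA cox_genK mulg1 !mulgA.
Qed.

(** In a relator the reflections met in the first half are met again, in the
    same order, in the second half. *)
Lemma crossings_relator s t r :
  crossings (flatten (nseq (M s t) [:: s; t])) r = false.
Proof.
rewrite -alt_double crossings_alt big_split_ord /=.
have c1 : (gen s * gen t) ^+ M s t = 1.
  rewrite -(cox_prod_relator s t); elim: (M s t) => [|m IHm].
    by rewrite cox_prod_nil expg0.
  by rewrite expgS IHm /= !cox_prod_cons mulgA.
rewrite [X in _ (+) X](_ : _ =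
  \big[addb/false]_(i < M s t) (r == (gen s * gen t) ^+ i * gen s)) ?addbb //.
by apply: eq_bigr => i _; rewrite expgnDr c1 mul1g.
Qed.

(** A relator adds no crossing, and does not move those that follow it because
    it is trivial in the group. *)
Lemma crossings_eq x y : prod x = prod y -> crossings x =1 crossings y.
Proof.
move=> /cox_prod_eqP/asboolP;
  elim=> {x y} [_ _ [u v s t]|//|x y _ IH|x y z _ IH1 _ IH2] r.
- rewrite !crossings_cat crossings_relator /=.
  by rewrite cox_prod_relator conjg1.
- by rewrite IH.
- by rewrite IH1.
Qed.

(** If [r = p s p^-1] for a prefix [p] followed by [s], then [r p s = p]. *)
Lemma crossings_deletion x r : crossings x r ->
  exists u s v, x = u ++ s :: v /\ r * prod x = prod (u ++ v).
Proof.
elim: x r => [//|s x IHx] r /=; case: eqP => [-> _|_ /= /IHx[u [t [v [-> e]]]]].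
  by exists [::], s, x; rewrite cox_prod_cons cox_genKl.
exists (s :: u), t, v; split=> //=.
by rewrite !cox_prod_cons -e conjgE cox_genV !mulgA cox_genK mul1g.
Qed.

Lemma cox_length_le x : (cox_length (prod x) <= size x)%N.
Proof.
by rewrite /cox_length; case: ex_minnP => m _; apply; apply/asboolP; exists x.
Qed.

Lemma reduced_min x y : reduced M x -> prod y = prod x -> (size x <= size y)%N.
Proof. by rewrite /reduced => <- <-; apply: cox_length_le. Qed.

Lemma exists_reduced w : exists2 x, reduced M x & prod x = w.
Proof.
have : `[< exists x, size x = cox_length w /\ prod x = w >].
  by rewrite /cox_length; case: ex_minnP.
by move=> /asboolP[x [sx wx]]; exists x; rewrite // /reduced wx.
Qed.

Lemma reduced_size_eq x y :
  reduced M x -> prod y = prod x -> size y = size x -> reduced M y.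
Proof. by rewrite /reduced => rx -> ->. Qed.

Lemma reduced_behead s x : reduced M (s :: x) -> reduced M x.
Proof.
move=> rx; have [y ry yx] := exists_reduced (prod x).
have := @reduced_min _ (s :: y) rx; rewrite !cox_prod_cons yx => /(_ erefl).
move=> /=; rewrite ltnS => le; apply: (reduced_size_eq ry) => //.
by apply/eqP; rewrite eqn_leq le reduced_min.
Qed.

Lemma reduced_crossings s x : reduced M (s :: x) -> crossings (s :: x) (gen s).
Proof.
move=> rx /=; rewrite eqxx conjgE cox_genV cox_genK mulg1 /=.
apply/negP => /crossings_deletion[u [t [v [ex e]]]].
have := @reduced_min _ (u ++ v) rx; rewrite cox_prod_cons -e ex => /(_ erefl).
by rewrite /= !size_cat /= addnS; lia.
Qed.

(** If the reflection [s] were not crossed by [x], it would be crossed by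
    [s x], hence by a shorter expression of the same element; the deletion that
    results would give an expression of the product of [x] that is too short. *)
Lemma exchange s x : reduced M x -> ~ reduced M (s :: x) ->
  exists u t v, x = u ++ t :: v /\ gen s * prod x = prod (u ++ v).
Proof.
move=> rx nrsx; apply: crossings_deletion.
have [y ry yE] := exists_reduced (prod (s :: x)).
have : crossings (s :: x) (gen s) = crossings y (gen s) by exact: crossings_eq.
rewrite /= eqxx conjgE cox_genV cox_genK mulg1 /=.
case: (crossings x _) => //= /esym/crossings_deletion[u [t [v [ey e]]]].
case: nrsx; apply: (reduced_size_eq ry) => //.
have := @reduced_min _ (u ++ v) rx.
rewrite -e yE cox_prod_cons cox_genKl => /(_ erefl) le1.
have := @reduced_min _ (s :: x) ry; rewrite yE => /(_ erefl).
by move: le1; rewrite ey /= !size_cat /=; lia.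
Qed.

(** The defining relations only say that the order of [s t] divides [M s t]. *)
Definition exact_orders : Prop :=
  forall s t j, (0 < j)%N -> M s t = 0%N \/ (j < M s t)%N ->
    (gen s * gen t) ^+ j <> 1.

(** If [s] and [t] are both left descents of [w], then [w] has reduced
    expressions that begin with alternating words in [s] and [t], of any length
    up to the order of [s t]: the deletion given by the descent [s] cannot occur
    in a prefix [t s t ...] that is shorter than this order. *)
Lemma dihedral_prefix s t x j : exact_orders -> M s t = 0%N \/ (j <= M s t)%N ->
    reduced M x -> crossings x (gen s) -> crossings x (gen t) ->
  exists2 z, size (alt j s t ++ z) = size x & prod (alt j s t ++ z) = prod x.
Proof.
move=> ord; elim: j s t => [|j IHj] s t jm rx xs xt; first by exists x.
have [|z zsz zx] := IHj t s _ rx xt xs; first by rewrite cox_m_sym; lia.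
have: crossings (alt j t s ++ z) (gen s) by rewrite (crossings_eq zx).
rewrite crossings_cat crossings_alt big1 => [/=|i _]; last first.
  apply/negP => /eqP e; apply: (ord t s i.+1) => //.
    by rewrite cox_m_sym; case: jm => jm; [left|right; have := ltn_ord i; lia].
  by rewrite expgSr mulgA -e cox_genK.
move=> /crossings_deletion[u [r [v [ez e]]]]; exists (u ++ v).
  by rewrite -zsz ez /= !size_cat /=; lia.
rewrite -zx /= cox_prod_cons cox_prod_cat -e conjgE cox_prod_cat.
by rewrite -[in X in _ * X]mulgA mulVKg -!mulgA cox_genKl.
Qed.

End Exchange.

(** * Commutation classes and full commutativity *)

Section Commutation.
Variables (S : finType) (M : coxMatrix S).
Local Notation gen := (cox_gen M).
Local Notation prod := (cox_prod M).
Implicit Types (s t r : S) (x y z u v f : seq S).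

Definition commeq x y : Prop := clos_refl_trans _ (commutation_step M) x y.

Lemma commeq_refl x : commeq x x.
Proof. exact: rt_refl. Qed.

Lemma commeq_trans y x z : commeq x y -> commeq y z -> commeq x z.
Proof. exact: rt_trans. Qed.

Lemma commeq_swap u v s t : M s t = 2 ->
  commeq (u ++ [:: s, t & v]) (u ++ [:: t, s & v]).
Proof. by move=> st; apply: rt_step; apply: CommutationStep. Qed.

Lemma commeq_sym x y : commeq x y -> commeq y x.
Proof.
elim=> {x y} [_ _ [u v s t st]|x|x y z _ xy _ yz]; last exact: commeq_trans xy.
  by apply: commeq_swap; rewrite cox_m_sym.
exact: commeq_refl.
Qed.

Lemma commeq_ctx u v x y : commeq x y -> commeq (u ++ x ++ v) (u ++ y ++ v).
Proof.
elim=> {x y} [_ _ [a b s t st]|x|x y z _ xy _ yz]; last exact: commeq_trans yz.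
  by rewrite -!catA !(catA u); apply: commeq_swap.
exact: commeq_refl.
Qed.

Lemma commeq_cons s x y : commeq x y -> commeq (s :: x) (s :: y).
Proof. by move=> /(commeq_ctx [:: s] [::]); rewrite !cats0. Qed.

Lemma commeq_invariant (T : Type) (g : seq S -> T) x y :
    (forall u v s t, M s t = 2 ->
       g (u ++ [:: s, t & v]) = g (u ++ [:: t, s & v])) ->
  commeq x y -> g x = g y.
Proof.
move=> gE; elim=> {x y} [_ _ [u v s t st]|//|x y z _ xy _ yz]; first exact: gE.
by rewrite xy.
Qed.

Lemma commeq_prod x y : commeq x y -> prod x = prod y.
Proof.
apply: commeq_invariant => u v s t st.
rewrite !cox_prod_cat !cox_prod_cons; congr (_ * _)%g; rewrite !mulgA.
congr (_ * _)%g; apply: divg1_eq; rewrite invgM !cox_genV mulgA.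
have := cox_prod_relator M s t; rewrite st /= !cox_prod_cons cox_prod_nil.
by rewrite mulg1 !mulgA.
Qed.

Lemma commeq_perm x y : commeq x y -> perm_eq x y.
Proof.
elim=> {x y} [_ _ [u v s t _]|//|x y z _ xy _ yz]; last exact: perm_trans yz.
by rewrite perm_cat2l -(cat1s s) -(cat1s t) -(cat1s t) -(cat1s s) perm_catCA.
Qed.

Lemma commeq_filter s t x y : M s t != 2 -> commeq x y ->
  filter (pred2 s t) x = filter (pred2 s t) y.
Proof.
move=> st; apply: commeq_invariant => u v a b ab; rewrite !filter_cat /=.
have [as_|as_] := eqVneq a s; have [bs|bs] := eqVneq b s => //=.
- by rewrite as_ bs.
- by have [bt|//] := eqVneq b t; rewrite -as_ -bt ab in st.
- by have [at_|//] := eqVneq a t; rewrite cox_m_sym -at_ -bs ab in st.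
- have [at_|//] := eqVneq a t; have [bt|//] := eqVneq b t.
  by rewrite at_ bt.
Qed.

Lemma commeq_move s u : all (fun r => M s r == 2) u ->
  forall v, commeq (s :: u ++ v) (u ++ s :: v).
Proof.
elim: u => [|a u IHu] /= => [_ v|/andP[/eqP sa ua] v]; first exact: commeq_refl.
apply: (@commeq_trans [:: a, s & u ++ v]); first exact: (commeq_swap [::]).
exact/commeq_cons/IHu.
Qed.

(** The first letter [s] of [x] can be brought to the front of [y]: a letter
    that precedes it in [y] without commuting with it would come first in the
    projection to this pair. *)
Lemma commeq_filterP x y :
    (forall s t, M s t != 2 -> filter (pred2 s t) x = filter (pred2 s t) y) ->
  commeq x y.
Proof.
have Mss s : M s s != 2.
  by have := cox_m_diag M s s; rewrite eqxx => /eqP ->.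
elim: x y => [|s x IHx] y xy.
  case: y xy => [_|s y /(_ s s (Mss s))]; first exact: commeq_refl.
  by rewrite /= eqxx.
have sy : s \in y.
  have : s \in filter (pred2 s s) y by rewrite -xy //= eqxx inE eqxx.
  by rewrite mem_filter => /andP[].
have [a [b0 [ey sa]]] : exists a b, y = a ++ s :: b /\ s \notin a.
  case/splitPr: sy => a b; elim: a {xy IHx} => [|c a [a' [b' [e sa]]]].
    by exists [::], b.
  have [->|cs] := eqVneq s c; first by exists [::], (a ++ c :: b).
  by exists (c :: a'), b'; rewrite /= e inE negb_or cs.
subst y.
have sa2 : all (fun r => M s r == 2) a.
  apply/allP => r ra; apply: contraT => sr.
  have := xy s r sr; rewrite filter_cat /= eqxx /=.
  have : filter (pred2 s r) a != [::].
    by rewrite -has_filter; apply/hasP; exists r; rewrite //= eqxx orbT.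
  case e: (filter _ a) => [//|c l] _ [cs _].
  have : c \in filter (pred2 s r) a by rewrite e inE eqxx.
  by rewrite mem_filter -cs (negPf sa) andbF.
apply: (@commeq_trans (s :: a ++ b0)); last exact: commeq_move.
apply/commeq_cons/IHx => c d cd.
have := xy c d cd; rewrite !filter_cat /=.
have [sc|_] := boolP ((s == c) || (s == d)); last by [].
suff -> : filter (pred2 c d) a = [::] by case.
apply/eqP; rewrite -[_ == _]negbK -has_filter; apply/hasPn => r ra /=.
have rs : r != s by apply: contraNneq sa => <-.
have := allP sa2 _ ra; move=> /eqP sr2; rewrite negb_or.
case/orP: sc => /eqP sc; subst s; rewrite rs ?andbT /=.
  by apply: contraNneq cd => <-; rewrite sr2.
by apply: contraNneq cd => <-; rewrite cox_m_sym sr2.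
Qed.

(** The factors that no reduced expression of a fully commutative element
    contains. *)
Inductive forbidden : seq S -> Prop :=
| Square s : forbidden [:: s; s]
| Braid s t of 2 < M s t : forbidden (alt (M s t) s t).

Definition braid_free x : Prop :=
  forall u f v, forbidden f -> ~ commeq x (u ++ f ++ v).

Lemma braid_free_commeq x y : commeq x y -> braid_free x -> braid_free y.
Proof. by move=> xy bx u f v ff yf; apply: (bx u f v ff); apply: commeq_trans yf. Qed.

Lemma braid_free_behead s x : braid_free (s :: x) -> braid_free x.
Proof. by move=> bx u f v ff /(commeq_cons s); apply: (bx (s :: u)). Qed.

(** For alternating words of length [m],
    [(s t s ...) (t s t ...)^-1 = (s t)^m]. *)
Lemma cox_prod_alt s t : prod (alt (M s t) s t) = prod (alt (M s t) t s).
Proof.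
have main m : (prod (alt m s t) * (prod (alt m t s))^-1 = (gen s * gen t) ^+ m)%g.
  elim: m => [|m IHm] /=; first by rewrite cox_prod_nil invg1 mulg1 expg0.
  have cV : ((gen s * gen t) ^+ m)^-1%g = (((gen s * gen t) ^+ m) ^ gen s)%g.
    by rewrite conjXg -expVgn invgM !cox_genV conjgE cox_genV !mulgA cox_genK mul1g.
  rewrite !cox_prod_cons invgM cox_genV mulgA -(mulgA (gen s)).
  rewrite -[(prod (alt m t s) * _)%g]invgK invgM invgK IHm cV conjgE cox_genV.
  by rewrite cox_genKl expgSr !mulgA.
apply: divg1_eq; rewrite main -(cox_prod_relator M s t).
elim: (M s t) => [|m IHm]; first by rewrite cox_prod_nil expg0.
by rewrite expgS IHm /= !cox_prod_cons mulgA.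
Qed.

Lemma altC_neq m s t : 0 < m -> s != t -> alt m s t <> alt m t s.
Proof. by case: m => // m _ /eqP st []. Qed.

(** A square could be deleted from a reduced expression; rewriting a braid
    factor gives a reduced expression in which its two letters occur in another
    order, and commutations preserve this order. *)
Lemma fully_commutative_braid_free x :
  reduced M x -> fully_commutative (prod x) -> braid_free x.
Proof.
move=> rx fcx u f v [s|s t st] xf.
  have := @reduced_min _ _ _ (u ++ v) rx; rewrite (commeq_prod xf).
  rewrite !cox_prod_cat !cox_prod_cons cox_prod_nil mulg1 cox_genK mul1g.
  by move=> /(_ erefl); rewrite (perm_size (commeq_perm xf)) !size_cat /=; lia.
have sz := perm_size (commeq_perm xf).
have ry : reduced_expr (prod x) (u ++ alt (M s t) s t ++ v).
  by split; [|apply: (reduced_size_eq rx)]; rewrite ?(commeq_prod xf).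
have rz : reduced_expr (prod x) (u ++ alt (M s t) t s ++ v).
  split; [|apply: (reduced_size_eq rx)].
  - by rewrite (commeq_prod xf) !cox_prod_cat cox_prod_alt.
  - by rewrite (commeq_prod xf) !cox_prod_cat cox_prod_alt.
  - by rewrite sz !size_cat !size_alt.
have st2 : M s t != 2 by lia.
have := commeq_filter st2 (fcx _ _ ry rz).
rewrite !filter_cat.
have altP m a b : {subset [:: a; b] <= pred2 s t} ->
    filter (pred2 s t) (alt m a b) = alt m a b.
  elim: m a b => //= m IHm a b ab; have := ab a; rewrite !inE eqxx => /(_ isT) ->.
  by rewrite IHm // => c cab; apply: ab; rewrite !inE orbC in cab *.
rewrite !altP; last 2 first.
- by move=> c; rewrite !inE orbC.
- by move=> c; rewrite !inE.
move=> /eqP; rewrite eqseq_cat // eqxx /= eqseq_cat ?size_alt // => /andP[/eqP e _].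
apply: altC_neq e; first lia.
by apply: contraL st => /eqP ->; have := cox_m_diag M t t; rewrite eqxx => /eqP ->.
Qed.

(** By induction on the size of [x]: if [x = s x'] were not
    reduced, the exchange property would give a reduced expression of [x'] that
    begins with [s], and [x] would be equivalent to a word that begins with
    [s s].  If [t] is the first letter of another reduced expression of the same
    element, there is an expression that begins with the alternating word of
    length [M s t] in [s] and [t]; deleting its first [s] gives one of [x'],
    which is in the commutation class of [x'].  So this alternating word is not
    forbidden, [s] and [t] commute, and [t] can be moved to the front of [x]. *)
Theorem braid_free_reduced x : exact_orders M -> braid_free x ->
  reduced M x /\ forall y, reduced M y -> prod y = prod x -> commeq x y.
Proof.
move=> ord; have [n] := ubnP (size x); elim: n x => // n IHn [|s x] /=.
  move=> _ _; have r0 : reduced M [::].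
    by apply/eqP; rewrite -leqn0; apply: (cox_length_le M [::]).
  split=> // y ry /esym/(reduced_min ry); rewrite leqn0 size_eq0 => /eqP ->.
  exact: commeq_refl.
rewrite ltnS => xn bx; have bx' := braid_free_behead bx.
have [rx xE] := IHn x xn bx'.
have rsx : reduced M (s :: x).
  have [//|nr] := pselect (reduced M (s :: x)).
  have [u [t [v [ex e]]]] := exchange rx nr.
  have eq1 : prod (s :: u ++ v) = prod x by rewrite cox_prod_cons -e cox_genKl.
  have xs : commeq x (s :: u ++ v).
    apply: xE => //; apply: (reduced_size_eq rx) => //.
    by rewrite ex /= !size_cat /= addnS.
  by case: (bx [::] [:: s; s] (u ++ v) (Square s)); apply: commeq_cons.
split=> // y ry yx.
have sz : size y = (size x).+1.
  by apply/anti_leq/andP; split;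
    [exact: (reduced_min ry (esym yx))|exact: (reduced_min rsx yx)].
case: y => // t y in ry yx sz *.
suff [z xz] : exists z, commeq (s :: x) (t :: z).
  have bz := braid_free_behead (braid_free_commeq xz bx).
  have zs : size z = size x by have := perm_size (commeq_perm xz) => /= -[].
  have [|rz zE] := IHn z _ bz; first by rewrite zs.
  apply: (commeq_trans xz); apply/commeq_cons/zE; first exact: reduced_behead ry.
  have := commeq_prod xz; rewrite -yx !cox_prod_cons.
  by move=> /(congr1 ( *%g (gen t))); rewrite !cox_genKl.
have sx := reduced_crossings rsx.
have tx : crossings (s :: x) (gen t).
  by rewrite -(crossings_eq yx); apply: reduced_crossings.
have prefix m : M s t = 0 \/ m.+1 <= M s t ->
    exists z, m <= size x /\ commeq (s :: x) (alt m.+1 s t ++ z).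
  move=> ms; have [z zs ze] := dihedral_prefix ord ms rsx sx tx.
  exists z; split.
    by move: zs; rewrite size_cat size_alt /=; lia.
  rewrite /=; apply/commeq_cons/xE.
    apply: (reduced_size_eq rx); last by case: zs.
    by apply: (can_inj (cox_genKl s)); rewrite -!cox_prod_cons.
  by apply: (can_inj (cox_genKl s)); rewrite -!cox_prod_cons.
case Mst: (M s t) => [|[|[|m]]].
- by have [|z [+ _]] := prefix (size x).+1; [left|rewrite ltnn].
- have /eqP : M s t == 1 by rewrite Mst.
  move=> /eqP; rewrite cox_m_diag => /eqP <-; exists x; exact: commeq_refl.
- have [|z [_ xz]] := prefix 1; first by right; rewrite Mst.
  exists (s :: z); apply: commeq_trans xz _.
  exact: (commeq_swap [::]).
- have [|z [_ xz]] := prefix m.+2; first by right; rewrite Mst.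
  have := bx [::] (alt (M s t) s t) z; rewrite Mst => nf; case: nf => //.
  by rewrite -Mst; apply: Braid; rewrite Mst.
Qed.

(** * Cyclically fully commutative words *)

Definition cyc_braid_free x : Prop := forall i, braid_free (rot i x).

Definition cfc_word x : Prop := forall y, commeq x y -> cyc_braid_free y.

Lemma cfc_word_braid_free x : cfc_word x -> braid_free x.
Proof. by move=> /(_ x (commeq_refl x) 0); rewrite rot0. Qed.

Lemma CFC_of_lengthP w k : exact_orders M ->
  CFC_of_length M k w <-> exists x, [/\ size x = k, cfc_word x & prod x = w].
Proof.
move=> ord; split=> [[cw lw]|[x [xk cx xw]]].
  have [x rx xw] := exists_reduced w; exists x; split=> // [|y xy i].
    by rewrite -lw -xw.
  have ry : reduced_expr w y.
    split; first by rewrite -(commeq_prod xy).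
    apply: (reduced_size_eq rx); first by rewrite (commeq_prod xy).
    exact/esym/perm_size/commeq_perm.
  by have [ri fi] := cw y i ry; apply: fully_commutative_braid_free.
have [rx xE] := braid_free_reduced ord (cfc_word_braid_free cx).
split=> [y i [yw ry]|]; last by rewrite -xw -xk.
have xy : commeq x y by apply: xE; rewrite ?yw.
have [ri iE] := braid_free_reduced ord (cx y xy i); split=> // a b [aw ra] [bw rb].
exact: commeq_trans (commeq_sym (iE a ra aw)) (iE b rb bw).
Qed.

Lemma cfc_word_prod_eq x y : exact_orders M -> cfc_word x -> cfc_word y ->
  prod x = prod y <-> commeq x y.
Proof.
move=> ord cx cy; split=> [e|/commeq_prod//].
have [rx xE] := braid_free_reduced ord (cfc_word_braid_free cx).
by apply: xE => //; have [] := braid_free_reduced ord (cfc_word_braid_free cy).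
Qed.

End Commutation.

(** * Orders of the products of two generators *)

Section NumbersGame.
Import GRing.Theory.
Local Open Scope ring_scope.
Variables (S : finType) (M : coxMatrix S) (a : S -> S -> int).
Hypothesis a_diag : forall s, a s s = 2.
Hypothesis a_cox : forall s t, s != t ->
  [\/ [/\ M s t = 2%N, a s t = 0 & a t s = 0],
      [/\ M s t = 3%N, a s t = -1 & a t s = -1],
      [/\ M s t = 4%N, a s t = -1 & a t s = -2]
    | [/\ M s t = 4%N, a s t = -2 & a t s = -1]].

(** The reflection representation for the generalised Cartan matrix [a], in its
    action on the values of a linear form at the simple roots. *)
Definition fire (f : S -> int) (s : S) : S -> int := fun r => f r - a s r * f s.

Definition play (x : seq S) (f : S -> int) : S -> int := foldl fire f x.

Lemma play_relator s t f : play (flatten (nseq (M s t) [:: s; t])) f = f.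
Proof.
apply/funext => r; have [<-|st] := eqVneq s t.
  have /eqP -> : M s s == 1%N by rewrite cox_m_diag.
  by rewrite /= /fire a_diag; ring.
by case: (a_cox st) => -[-> st1 st2]; rewrite /= /fire !a_diag st1 st2; ring.
Qed.

Lemma play_eq x y : cox_prod M x = cox_prod M y -> play x =1 play y.
Proof.
move=> /cox_prod_eqP/asboolP.
elim=> {x y} [_ _ [u v s t]|//|x y _ IH|x y z _ IH1 _ IH2] f.
- by rewrite /play !foldl_cat -/(play u f) [X in foldl _ X v]play_relator.
- by rewrite IH.
- by rewrite IH1.
Qed.

(** The position with value 1 at [s] and 0 elsewhere comes back to itself under
    [(s t)^j] only when [j] is a multiple of [M s t]. *)
Lemma exact_orders_cartan : exact_orders M.
Proof.
move=> s t j j0 jM cj.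
have st : s != t.
  apply/eqP => st; move: jM; rewrite -st.
  have /eqP -> : M s s == 1%N by rewrite cox_m_diag.
  by case=> //; case: (j) j0.
have : cox_prod M (flatten (nseq j [:: s; t])) = cox_prod M [::].
  rewrite cox_prod_nil -cj; elim: (j) => [|m IHm]; first exact: cox_prod_nil.
  by rewrite expgS -IHm /= !cox_prod_cons mulgA.
pose f r : int := (r == s)%:R.
move=> /play_eq/(_ f) e.
have es : play (flatten (nseq j [:: s; t])) f s = 1 by rewrite e /= /f eqxx.
have et : play (flatten (nseq j [:: s; t])) f t = 0.
  by rewrite e /= /f eq_sym (negPf st).
move: es et => {e}; case: (a_cox st) => -[Mst ast ats]; rewrite Mst in jM;
  case: j => [|[|[|[|j]]]] in j0 jM cj *; try lia;
  rewrite /play /= /fire !a_diag ?ast ?ats /f eqxx eq_sym (negPf st) //; lia.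
Qed.

End NumbersGame.

Section Fork.
Variable n : nat.
Hypothesis n2 : 1 < n.
Implicit Types s t : fork n.
Local Open Scope ring_scope.

Definition fork_cartan (long : pred (fork n)) s t : int :=
  if s == t then 2 else if fork_edge s t then (if long s then -2 else -1) else 0.

Lemma D_exact_orders : exact_orders (D_matrix n).
Proof.
apply: (@exact_orders_cartan _ _ (fork_cartan xpred0)) => [s|s t st].
  by rewrite /fork_cartan eqxx.
rewrite /fork_cartan /= /D_m (eq_sym t) (negPf st) (fork_edge_sym t).
by case: (fork_edge s t); [apply: Or42|apply: Or41].
Qed.

Lemma affB_exact_orders : exact_orders (affB_matrix n).
Proof.
apply: (@exact_orders_cartan _ _ (fork_cartan (@fork_end n))) => [s|s t st].
  by rewrite /fork_cartan eqxx.
rewrite /fork_cartan /= /affB_m (eq_sym t) (negPf st) (fork_edge_sym t).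
case E: (fork_edge s t); last by apply: Or41.
case es: (fork_end s); case et: (fork_end t); rewrite /= ?orbT.
- by case: s t E es et {st} => [b|i] [c|j] //=; lia.
- by apply: Or44.
- by apply: Or43.
- by apply: Or42.
Qed.

End Fork.

(** * Cyclic gaps between the occurrences of a letter *)

Section Gaps.
Variable T : eqType.
Implicit Types (s a c : T) (w b x y : seq T) (bs : seq (seq T)) (p : pred T).

Lemma rot_rotE i j w : exists k, rot i (rot j w) = rot k w.
Proof.
have [wi|iw] := leqP (size w) i.
  by exists j; rewrite [LHS]rot_oversize // size_rot.
have [wj|jw] := leqP (size w) j; first by exists i; rewrite [rot j w]rot_oversize.
by eexists; rewrite rot_add_mod //; apply: ltnW.
Qed.

Lemma rot_back j w : exists k, rot k (rot j w) = w.
Proof. by exists (size (rot j w) - j); apply: rotK. Qed.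

Lemma count_rot p j w : count p (rot j w) = count p w.
Proof. by apply/permP; rewrite perm_rot. Qed.

(** A cyclic word cut just before an occurrence of [s] is the list of its gaps,
    the last of which extends to the cut. *)
Definition join_gaps s bs : seq T := flatten [seq s :: b | b <- bs].

Lemma join_gaps_cons s b bs : join_gaps s (b :: bs) = s :: b ++ join_gaps s bs.
Proof. by []. Qed.

Lemma join_gaps_cat s bs bs' : join_gaps s (bs ++ bs') =
  join_gaps s bs ++ join_gaps s bs'.
Proof. by rewrite /join_gaps map_cat flatten_cat. Qed.

Lemma join_gaps_rcons s bs b : join_gaps s (rcons bs b) = join_gaps s bs ++ s :: b.
Proof. by rewrite -cats1 join_gaps_cat /join_gaps /= cats0. Qed.

Lemma count_join_gaps p s bs :
  count p (join_gaps s bs) = p s * size bs + sumn (map (count p) bs).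
Proof. by elim: bs => [|b bs IH] /=; rewrite ?muln0 // count_cat IH; lia. Qed.

Lemma count_mem_join_gaps s bs : all (fun b => s \notin b) bs ->
  count_mem s (join_gaps s bs) = size bs.
Proof.
move=> sbs; rewrite count_join_gaps /= eqxx mul1n -[RHS]addn0; congr (_ + _).
by elim: bs sbs => //= b bs IH /andP[/count_memPn -> /IH].
Qed.

Lemma filter_join_gaps p s bs : p s ->
  filter p (join_gaps s bs) = join_gaps s (map (filter p) bs).
Proof.
by move=> ps; elim: bs => //= b bs IH; rewrite ps filter_cat -/(join_gaps s bs) IH.
Qed.

Lemma join_gapsP s w : exists b0 bs,
  [/\ w = b0 ++ join_gaps s bs, s \notin b0 & all (fun b => s \notin b) bs].
Proof.
elim: w => [|r w [b0 [bs [-> sb0 sbs]]]]; first by exists [::], [::].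
have [<-|sr] := eqVneq s r; last by exists (r :: b0), bs; rewrite inE negb_or sr.
by exists [::], (b0 :: bs); rewrite /= sb0.
Qed.

Lemma join_gaps_rot s w : 0 < count_mem s w ->
  exists j bs, rot j w = join_gaps s bs /\ all (fun b => s \notin b) bs.
Proof.
have [b0 [bs [-> sb0]]] := join_gapsP s w.
case/lastP: bs => [|bs bl]; first by rewrite cats0 => _; rewrite (count_memPn sb0).
rewrite all_rcons => /andP[sbl sbs] _.
exists (size b0), (rcons bs (bl ++ b0)).
rewrite rot_size_cat !join_gaps_rcons -catA /=; split=> //.
by rewrite all_rcons mem_cat negb_or sbl sb0.
Qed.

(** The condition that every gap [b] between cyclically consecutive occurrences
    of [s] in [w] contains at least (resp. exactly) [k] letters in [p].  The
    first condition is void when [s] occurs once in [w]. *)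
Definition gaps_ge w s p k : Prop := forall j b x,
  rot j w = s :: b ++ s :: x -> s \notin b -> k <= count p b.

Definition gaps_eq w s p k : Prop := forall j bs,
  rot j w = join_gaps s bs -> all (fun b => s \notin b) bs ->
  all (fun b => count p b == k) bs.

Lemma join_gaps_rot_gaps w j s bs i : rot j w = join_gaps s bs ->
  exists k, rot k w = join_gaps s (rot i bs).
Proof.
move=> e; have [k ek] := rot_rotE (size (join_gaps s (take i bs))) j w.
have eg : join_gaps s bs = join_gaps s (take i bs) ++ join_gaps s (drop i bs).
  by rewrite -join_gaps_cat cat_take_drop.
by exists k; rewrite -ek e eg rot_size_cat /rot join_gaps_cat.
Qed.

Lemma join_gaps_gap w j s bs1 b bs2 :
    rot j w = join_gaps s (bs1 ++ b :: bs2) -> 0 < size (bs1 ++ bs2) ->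
  exists i x, rot i w = s :: b ++ s :: x.
Proof.
move=> e; have [k ek] := rot_rotE (size (join_gaps s bs1)) j w.
move: ek; rewrite e join_gaps_cat rot_size_cat /= -/(join_gaps s bs2) => ek.
case: bs2 => [|b2 bs2] in e ek *; last first.
  move=> _; exists k, (b2 ++ join_gaps s bs2 ++ join_gaps s bs1).
  by rewrite -ek /= -!catA.
case: bs1 => [|b1 bs1] in e ek * => // _; exists k, (b1 ++ join_gaps s bs1).
by rewrite -ek /= cats0.
Qed.

Lemma gaps_ge_all w s p k j bs : gaps_ge w s p k -> 1 < size bs ->
    rot j w = join_gaps s bs -> all (fun b => s \notin b) bs ->
  all (fun b => k <= count p b) bs.
Proof.
move=> ge sz e sbs; apply/allP => b bbs; have sb := allP sbs b bbs.
case/splitPr: bbs => [bs1 bs2] in sz e *.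
have [|i [x ex]] := join_gaps_gap e; last exact: ge ex sb.
by move: sz; rewrite !size_cat /=; lia.
Qed.

Lemma sumn_ge (ms : seq nat) k : all (leq k) ms ->
  k * size ms <= sumn ms /\ (sumn ms = k * size ms -> all (eq_op^~ k) ms).
Proof.
elim: ms => [|m ms IH] /=; first by rewrite muln0.
move=> /andP[km /IH[le eqm]]; split=> [|e]; first by rewrite mulnS leq_add.
have mk : m = k by lia.
by rewrite mk eqxx eqm //; lia.
Qed.

Lemma gaps_sum w s p k : ~~ p s -> gaps_ge w s p k -> 1 < count_mem s w ->
  k * count_mem s w <= count p w.
Proof.
move=> ps ge c1; have [//|j [bs [e sbs]]] := @join_gaps_rot s w; first by lia.
have cs : count_mem s w = size bs by rewrite -(count_rot _ j) e count_mem_join_gaps.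
have := gaps_ge_all ge _ e sbs; rewrite -cs => /(_ c1) ge_bs.
rewrite -(count_rot p j) e count_join_gaps (negPf ps) cs /=.
have [|+ _] := @sumn_ge (map (count p) bs) k; first by rewrite all_map.
by rewrite size_map; lia.
Qed.

Lemma gaps_exact w s p k : ~~ p s -> gaps_ge w s p k -> 1 < count_mem s w ->
  count p w = k * count_mem s w -> gaps_eq w s p k.
Proof.
move=> ps ge c1 eqk j bs e sbs.
have cs : count_mem s w = size bs by rewrite -(count_rot _ j) e count_mem_join_gaps.
have := gaps_ge_all ge _ e sbs; rewrite -cs => /(_ c1) ge_bs.
have [|_] := @sumn_ge (map (count p) bs) k; first by rewrite all_map.
rewrite size_map all_map; apply.
by move: eqk; rewrite -(count_rot p j) e count_join_gaps (negPf ps) cs.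
Qed.

Lemma gaps_eq_rot w s p k i : gaps_eq w s p k -> gaps_eq (rot i w) s p k.
Proof.
by move=> ex j bs; have [l ->] := rot_rotE j i w; apply: ex.
Qed.

(** ** Linear and cyclic gap counts *)

(** A word in the letters [s] and [a] that begins with [s] is determined by the
    numbers of letters [a] between the occurrences of [s]. *)
Definition comb s a (ms : seq nat) : seq T := join_gaps s [seq nseq m a | m <- ms].

Lemma comb_cons s a m ms : comb s a (m :: ms) = s :: nseq m a ++ comb s a ms.
Proof. by []. Qed.

Lemma filter_pred2_gap s a b : s \notin b ->
  filter (pred2 s a) b = nseq (count_mem a b) a.
Proof.
elim: b => //= r b IH; rewrite inE negb_or eq_sym => /andP[/negPf -> /IH ->] /=.
by case: eqP => [->|].
Qed.

Lemma filter_pred2_join_gaps s a b0 bs :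
    s \notin b0 -> all (fun b => s \notin b) bs ->
  filter (pred2 s a) (b0 ++ join_gaps s bs)
    = nseq (count_mem a b0) a ++ comb s a (map (count_mem a) bs).
Proof.
move=> sb0 sbs; rewrite filter_cat filter_pred2_gap // filter_join_gaps ?/= ?eqxx //.
rewrite /comb -map_comp; congr (_ ++ join_gaps _ _); apply/eq_in_map => b /(allP sbs).
exact: filter_pred2_gap.
Qed.

Lemma count_pred2 a c b : a != c ->
  count (pred2 a c) b = count_mem a b + count_mem c b.
Proof.
move=> ac; elim: b => //= r b ->.
by have [->|_] := eqVneq r a; rewrite ?(negPf ac) /=; lia.
Qed.

Lemma comb_inj s a m ms n ns : s != a ->
    nseq m a ++ comb s a ms = nseq n a ++ comb s a ns ->
  m = n /\ ms = ns.
Proof.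
move=> sa; elim: ms m n ns => [|k ms IH] m n ns.
  case: ns => [|l ns].
    by rewrite /comb /join_gaps /= !cats0 => /(congr1 size); rewrite !size_nseq.
  move=> /(congr1 (fun w => s \in w)).
  by rewrite !mem_cat !mem_nseq (negPf sa) !andbF /= in_nil inE eqxx.
elim: m n ns => [|m IHm] [|n] ns.
- case: ns => [//|l ns]; rewrite !comb_cons /= => -[/IH[-> ->]].
  by [].
- by move=> /= [e]; rewrite e eqxx in sa.
- case: ns => [|l ns] /=.
    rewrite -/(nseq m a ++ _) => /(congr1 (fun w => s \in w)).
    by rewrite inE mem_cat comb_cons inE eqxx !orbT.
  by case=> e; rewrite -e eqxx in sa.
- by move=> /= [/IHm[-> ->]].
Qed.

(** If the gaps of [s] contain exactly two letters in [{a, c}], the counts of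
    [a] between the occurrences of [s] determine those of [c], up to the cut of
    the last gap into the two ends of the word. *)
Lemma gaps_transfer w s a c m0 ms ml : s != a -> s != c -> a != c ->
    gaps_eq w s (pred2 a c) 2 ->
    filter (pred2 s a) w = nseq m0 a ++ comb s a (rcons ms ml) ->
  exists n0 nl, n0 + nl + (m0 + ml) = 2 /\
    filter (pred2 s c) w = nseq n0 c ++ comb s c (rcons [seq 2 - m | m <- ms] nl).
Proof.
move=> sa sc ac ex; have [b0 [bs [ew sb0 sbs]]] := join_gapsP s w.
rewrite {1}ew filter_pred2_join_gaps // => /comb_inj -/(_ sa)[eb0 ebs].
case/lastP: bs => [|bs bl] in ew sbs ebs.
  by case: ms ebs.
have countU b : count (pred2 a c) b = count_mem a b + count_mem c b.
  exact: count_pred2.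
move: ebs sbs; rewrite map_rcons all_rcons => /rcons_inj[ebs ebl] /andP[sbl sbs].
have := ex (size b0) (rcons bs (bl ++ b0)).
rewrite ew rot_size_cat !join_gaps_rcons -catA => /(_ erefl).
rewrite !all_rcons mem_cat negb_or sbl sb0 sbs => /(_ isT) /andP[/eqP e2 e2s].
exists (count_mem c b0), (count_mem c bl); split.
  by rewrite -eb0 -ebl -e2 countU !count_cat; lia.
rewrite -join_gaps_rcons filter_pred2_join_gaps ?all_rcons ?sbl //.
rewrite map_rcons -ebs -map_comp; congr (_ ++ comb _ _ (rcons _ _)).
apply/eq_in_map => b /(allP e2s)/eqP /=; rewrite countU; lia.
Qed.

(** ** Periodic two-letter words *)

Definition alternating k s a w : Prop :=
  w = flatten (nseq k [:: s; a]) \/ w = flatten (nseq k [:: a; s]).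

(** The rotations of the periodic word [(s a a)^k]. *)
Definition triple_word k s a w : Prop :=
  [\/ w = flatten (nseq k [:: s; a; a]), w = flatten (nseq k [:: a; s; a])
    | w = flatten (nseq k [:: a; a; s])].

Lemma pred2C s a : pred2 s a =1 pred2 a s.
Proof. by move=> r /=; rewrite orbC. Qed.

Lemma alternatingC k s a w : alternating k s a w -> alternating k a s w.
Proof. by case=> ->; [right|left]. Qed.

Lemma flatten_nseqS k (w : seq T) :
  flatten (nseq k.+1 w) = w ++ flatten (nseq k w).
Proof. by []. Qed.

Lemma comb_1 k s a : comb s a (nseq k 1) = flatten (nseq k [:: s; a]).
Proof. by elim: k => //= k <-. Qed.

Lemma comb_10 k s a :
  comb s a (flatten (nseq k [:: 1; 0])) = flatten (nseq k [:: s; a; s]).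
Proof. by elim: k => //= k <-. Qed.

Lemma comb_02 k s a :
  comb s a (flatten (nseq k [:: 0; 2])) = flatten (nseq k [:: s; s; a; a]).
Proof. by elim: k => //= k <-. Qed.

Lemma comb_sa k s a :
  flatten (nseq k.+1 [:: s; a]) = nseq 0 a ++ comb s a (rcons (nseq k 1) 1).
Proof. by elim: k => // k IHk; rewrite flatten_nseqS IHk. Qed.

Lemma comb_as k s a :
  flatten (nseq k.+1 [:: a; s]) = nseq 1 a ++ comb s a (rcons (nseq k 1) 0).
Proof. by elim: k => // k IHk; rewrite flatten_nseqS IHk. Qed.

Lemma comb_assa k s a :
  flatten (nseq k.+1 [:: a; s; s; a])
    = nseq 1 a ++ comb s a (rcons (rcons (flatten (nseq k [:: 0; 2])) 0) 1).
Proof. by elim: k => // k IHk; rewrite flatten_nseqS IHk. Qed.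

Lemma comb_saas k s a :
  flatten (nseq k.+1 [:: s; a; a; s])
    = nseq 0 a ++ comb s a (rcons (rcons (flatten (nseq k [:: 2; 0])) 2) 0).
Proof. by elim: k => // k IHk; rewrite flatten_nseqS IHk. Qed.

Lemma comb_saa k s a :
  flatten (nseq k.+1 [:: s; a; a]) = nseq 0 a ++ comb s a (rcons (nseq k 2) 2).
Proof. by elim: k => // k IHk; rewrite flatten_nseqS IHk. Qed.

Lemma comb_asa k s a :
  flatten (nseq k.+1 [:: a; s; a]) = nseq 1 a ++ comb s a (rcons (nseq k 2) 1).
Proof. by elim: k => // k IHk; rewrite flatten_nseqS IHk. Qed.

Lemma comb_aas k s a :
  flatten (nseq k.+1 [:: a; a; s]) = nseq 2 a ++ comb s a (rcons (nseq k 2) 0).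
Proof. by elim: k => // k IHk; rewrite flatten_nseqS IHk. Qed.

(** A gap of [s] that contains one [a] has room for one [c]. *)
Lemma alternating_transfer k w s a c : s != a -> s != c -> a != c -> 0 < k ->
    gaps_eq w s (pred2 a c) 2 -> alternating k s a (filter (pred2 s a) w) ->
  alternating k c s (filter (pred2 s c) w).
Proof.
case: k => // k sa sc ac _ ex; rewrite /alternating (comb_as k s a) (comb_sa k s a).
move=> alt_w; have {alt_w} [ms0 [msl [e2 e]]] : exists m0 ml, m0 + ml = 1 /\
    filter (pred2 s a) w = nseq m0 a ++ comb s a (rcons (nseq k 1) ml).
  by case: alt_w => ->; [exists 0, 1|exists 1, 0].
have [n0 [nl [en ->]]] := gaps_transfer sa sc ac ex e; rewrite map_nseq.
rewrite (comb_sa k s c) (comb_as k s c).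
have [[-> ->]|[-> ->]] : n0 = 0 /\ nl = 1 \/ n0 = 1 /\ nl = 0 by lia.
  by right.
by left.
Qed.

(** The gaps of [s] without [a] contain [c] twice, and those with [a] twice
    contain no [c]; the cut falls inside a gap of the second kind. *)
Lemma zigzag_transfer k w s a c : s != a -> s != c -> a != c -> 0 < k ->
    gaps_eq w s (pred2 a c) 2 ->
    filter (pred2 s a) w = flatten (nseq k [:: a; s; s; a]) ->
  filter (pred2 s c) w = flatten (nseq k [:: s; c; c; s]).
Proof.
case: k => // k sa sc ac _ ex; rewrite (comb_assa k s a).
move=> /(gaps_transfer sa sc ac ex)[n0 [nl [e ->]]].
have [-> ->] : n0 = 0 /\ nl = 0 by lia.
by rewrite (comb_saas k s c) map_rcons map_flatten map_nseq.
Qed.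

Lemma triple_gaps k w s a : s != a -> 0 < k -> count_mem s w = k ->
    count_mem a w = 2 * k -> gaps_eq w s (pred1 a) 2 ->
  triple_word k s a (filter (pred2 s a) w).
Proof.
case: k => // k sa _ cs ca ex; have [b0 [bs [ew sb0 sbs]]] := join_gapsP s w.
have: size bs = k.+1.
  by rewrite -cs ew count_cat (count_memPn sb0) count_mem_join_gaps.
case/lastP: bs => [|bs bl] // in ew sbs *; rewrite size_rcons => -[sz].
rewrite ew filter_pred2_join_gaps // map_rcons.
move: sbs; rewrite all_rcons => /andP[sbl sbs].
have := ex (size b0) (rcons bs (bl ++ b0)).
rewrite ew rot_size_cat !join_gaps_rcons -catA => /(_ erefl).
rewrite !all_rcons mem_cat negb_or sbl sb0 sbs => /(_ isT) /andP[/eqP e2 e2s].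
have -> : map (count_mem a) bs = nseq k 2.
  by rewrite -sz -(size_map (count_mem a)); apply/all_pred1P; rewrite all_map.
move: e2; rewrite count_cat => e2.
rewrite /triple_word (comb_saa k s a) (comb_asa k s a) (comb_aas k s a).
have [[-> ->]|[[-> ->]|[-> ->]]] :
  count_mem a b0 = 0 /\ count_mem a bl = 2 \/
  (count_mem a b0 = 1 /\ count_mem a bl = 1 \/
   count_mem a b0 = 2 /\ count_mem a bl = 0) by lia.
- exact: Or31.
- exact: Or32.
- exact: Or33.
Qed.

Lemma rot1_ind (P : seq T -> Prop) i w :
  (forall y, P y -> P (rot 1 y)) -> P w -> P (rot i w).
Proof.
move=> P1 Pw; elim: i => [|i IH]; first by rewrite rot0.
have [iw|wi] := ltnP i (size w); first by rewrite (rotS iw); apply: P1.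
by rewrite rot_oversize // leqW.
Qed.

Lemma rot1_filter p w :
  filter p (rot 1 w) = filter p w \/ filter p (rot 1 w) = rot 1 (filter p w).
Proof.
case: w => [|r w]; first by left.
rewrite rot1_cons filter_rcons /=; case: (p r); last by left.
by right; rewrite rot1_cons.
Qed.

Lemma filter_rot_closed (P : seq T -> Prop) p w :
    (forall y, P y -> P (rot 1 y)) -> P (filter p w) ->
  forall i, P (filter p (rot i w)).
Proof.
move=> P1 Pw i; apply: (@rot1_ind (fun y => P (filter p y))) => // y Py.
by case: (rot1_filter p y) => ->; last apply: P1.
Qed.

Lemma rot1_pow k a w :
  rot 1 (flatten (nseq k (a :: w))) = flatten (nseq k (rcons w a)).
Proof.
case: k => // k; rewrite flatten_nseqS /= rot1_cons.
elim: k => [|k IHk] /=; first by rewrite !cats0.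
by rewrite -cat_rcons -IHk /= !rcons_cat.
Qed.

Lemma alternating_rot1 k s a w : alternating k s a w -> alternating k s a (rot 1 w).
Proof. by case=> ->; rewrite rot1_pow; [right|left]. Qed.

Lemma triple_word_rot1 k s a w : triple_word k s a w -> triple_word k s a (rot 1 w).
Proof.
by case=> ->; rewrite rot1_pow; [apply: Or33|apply: Or31|apply: Or32].
Qed.

End Gaps.

(** * Gaps next to the edge labelled 4 *)

Lemma cycle_rotP (T : eqType) (R : rel T) (s : seq T) : 1 < size s ->
  (forall i x y s', rot i s = [:: x, y & s'] -> R x y) -> cycle R s.
Proof.
case: s => [|x0 [|x1 p]] // _ Rs; rewrite /cycle rcons_path; apply/andP; split.
  apply/(pathP x0) => i ip; have ip' : i < size (x0 :: x1 :: p) by apply: ltnW.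
  apply: (Rs i); rewrite /rot (drop_nth x0 ip').
  by rewrite -[drop i.+1 _]/(drop i (x1 :: p)) (drop_nth x0 ip).
apply: (Rs (size (belast x0 (x1 :: p))) _ _ (behead (belast x0 (x1 :: p)))).
by rewrite {2}lastI -cats1 rot_size_cat.
Qed.

Section GapTypes.
Implicit Types (g h : nat * nat) (gs : seq (nat * nat)).

(** A gap is recorded as its numbers of letters from the two sides of the node:
    the first is the side of the edge labelled 4.  A gap [(1, 0)] is allowed,
    because [v u v] is not a braid factor, but two cyclically consecutive ones
    with letters [u], one of which is [(1, 0)], produce [v u v u] or
    [u v u v]. *)
Definition gap_ok g : bool := (g.1 <= 1) && ((g.1 == 0) ==> (2 <= g.2)).

Definition gap_next g h : bool :=
  ((g == (1, 0)) ==> (h.1 == 0)) && ((h == (1, 0)) ==> (g.1 == 0)).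

Local Notation zig k := (flatten (nseq k [:: (1, 0); (0, 2)])).

(** A gap [(1, 0)] contributes 0 to the sum, and the gap that follows it at
    least 2. *)
Lemma gap_path_sum g gs : path gap_next g gs -> all gap_ok (g :: gs) ->
    (last g gs).1 = 0 ->
  let sum := sumn (map snd (g :: gs)) in
  if g == (1, 0) then
    size (g :: gs) <= sum /\
    (sum = size (g :: gs) -> exists k, g :: gs = zig k)
  else
    (size (g :: gs)).+1 <= sum /\
    (sum = (size (g :: gs)).+1 -> g.1 = 0 -> g = (0, 2) /\ exists k, gs = zig k).
Proof.
elim: gs g => [|h gs IH] [e l].
  rewrite /gap_ok /= => _ + e0; rewrite e0 /= => /andP[l2 _].
  by split=> [|l3]; [lia|split; [congr pair; lia|exists 0]].
rewrite /= => /andP[gh hgs] /andP[g_ok hgs_ok] lst.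
have {IH} := IH h hgs hgs_ok lst; move: gh; rewrite /gap_next /= => gh.
have [gE|gN] := eqVneq (e, l) (1, 0).
  case: gE gh g_ok => -> -> /andP[/eqP h0 _] _.
  case: ifP => [/eqP hE|_ [le eqs]]; first by rewrite hE in h0.
  split=> [|sz]; first by lia.
  have [|//|-> [k ->]] := eqs; first by lia.
  by exists k.+1.
case: ifP => [/eqP hE|hN] [le eqs].
  rewrite (negPf gN) hE /= in gh.
  move: g_ok; rewrite /gap_ok /= gh /= => /andP[_ l2].
  split=> [|sz _]; first by lia.
  split; last by apply: eqs; lia.
  by congr pair; lia.
move: g_ok; rewrite /gap_ok /= => /andP[e1 l2].
have l1 : 0 < l.
  case: l gN l2 {gh} => // gN; case: e gN e1 => [|[|e]] //.
split=> [|sz e0]; first by lia.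
by rewrite e0 /= in l2; lia.
Qed.

(** When the second components are at most 1 on average, each [(1, 0)] must be
    compensated by a [(0, 2)] after it; a [(1, 1)] cannot come before a
    [(1, 0)], so there is no place for it. *)
Lemma gap_cycle gs : cycle gap_next gs -> all gap_ok gs ->
    sumn (map snd gs) <= size gs ->
  all (pred1 (1, 1)) gs \/ exists i k, rot i gs = zig k.
Proof.
move=> cyc ok le; have [pure|npure] := boolP ((1, 0) \in gs); [right|left].
  have [i gs' e] := rot_to pure; exists i.
  have cyc' : cycle gap_next (rot i gs) by rewrite rot_cycle.
  have ok' : all gap_ok (rot i gs).
    by rewrite (@eq_all_r _ _ gs) // => x; rewrite mem_rot.
  have le' : sumn (map snd (rot i gs)) <= size (rot i gs).
    by rewrite map_rot size_rot !sumnE (perm_big (map snd gs)) ?perm_rot // -sumnE.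
  move: cyc' ok' le'; rewrite e /= rcons_path => /andP[pgs] ngs ok' le'.
  have lst : (last (1, 0) gs').1 = 0 by move: ngs => /andP[_ /eqP].
  have := gap_path_sum pgs ok' lst; rewrite eqxx => -[le2 eqs].
  by apply: eqs; apply/anti_leq/andP.
have : all (fun m => 1 <= m) (map snd gs).
  rewrite all_map; apply/allP => -[e l] g_in /=.
  move: (allP ok _ g_in); rewrite /gap_ok /=.
  by case: l e g_in => [|//] [|[|e]] // g_in _; rewrite g_in in npure.
move=> /(@sumn_ge _ 1)[]; rewrite mul1n size_map => ge eqs.
have {ge le} /eqs := anti_leq (introT andP (conj le ge)).
rewrite all_map => all1; apply/allP => -[e l] g_in /=.
move: (allP ok _ g_in) (allP all1 _ g_in) => /=; rewrite /gap_ok /= => + /eqP l1.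
by rewrite l1; case: e {g_in} => [|[|e]].
Qed.

End GapTypes.

(** * Letter counts along the fork *)

Definition level_count (lam : seq nat) i := count_mem i lam.

Section LevelCounts.
Variables (lam : seq nat) (N : nat).
Local Notation c := (level_count lam).
Hypothesis c01 : 1 < c 1 -> c 0 <= c 1.
Hypothesis gaps2 : forall i, 0 < i < N -> gaps_ge lam i (pred2 i.+1 i.-1) 2.

Let neighbours i : 0 < i -> count (pred2 i.+1 i.-1) lam = c i.+1 + c i.-1.
Proof. by move=> i0; apply: count_pred2; lia. Qed.

Let not_neighbour i : 0 < i -> ~~ pred2 i.+1 i.-1 i.
Proof. by move=> i0 /=; lia. Qed.

Lemma level_convex i : 0 < i < N -> 1 < c i -> 2 * c i <= c i.+1 + c i.-1.
Proof.
move=> iN ci; have i0 : 0 < i by lia.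
rewrite -neighbours //; apply: gaps_sum => //; [exact: not_neighbour|exact: gaps2].
Qed.

(** A convex sequence that does not decrease at its first step never does. *)
Lemma level_mono i : 0 < i <= N -> 1 < c i -> c i.-1 <= c i.
Proof.
elim: i => // -[|i] IH iN ci; first exact: c01.
have [ci1|ci1] := leqP (c i.+1) 1; first by rewrite -pred_Sn; lia.
have iN' : 0 < i.+1 < N by lia.
have iN'' : 0 < i.+1 <= N by lia.
have := level_convex iN' ci1; have := IH iN'' ci1; rewrite -!pred_Sn; lia.
Qed.

Lemma level_step i : 0 < i < N -> 1 < c i -> c i <= c i.+1.
Proof.
move=> iN ci; have iN' : 0 < i <= N by lia.
by have := level_convex iN ci; have := level_mono iN' ci; lia.
Qed.

Lemma level_climb i : 0 < i <= N -> 1 < c i -> 1 < c N.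
Proof.
move: {2}(N - i) (erefl (N - i)) => d; elim: d i => [|d IH] i dE iN ci.
  by have -> : N = i by lia.
have iN' : 0 < i < N by lia.
by apply: (IH i.+1); have := level_step iN' ci; lia.
Qed.

Hypotheses (N0 : 0 < N) (cN : 1 < c N) (cN1 : c N.-1 = c N).

(** Equality in the last step forces equality in each step before it, by
    convexity. *)
Lemma level_const i : i <= N -> c i = c N.
Proof.
have main d : d < N -> c (N - d) = c N /\ c (N - d.+1) = c N.
  elim: d => [|d IH] dN; first by rewrite subn0 subn1.
  have [|c1 c2] := IH; first by lia.
  split=> //; set j := N - d.+1 in c2 *.
  have jN : 0 < j < N by rewrite /j; lia.
  have jN' : 0 < j <= N by lia.
  have ej : N - d = j.+1 by rewrite /j; lia.
  have ej' : N - d.+2 = j.-1 by rewrite /j; lia.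
  have cj : 1 < c j by rewrite c2.
  rewrite ej in c1; rewrite ej'.
  by have := level_convex jN cj; have := level_mono jN' cj; lia.
rewrite leq_eqVlt => /orP[/eqP -> //|iN].
have [|_] := main (N - i).-1; first by lia.
by rewrite (_ : N - (N - i).-1.+1 = i) //; lia.
Qed.

Lemma level_gaps i : 0 < i < N -> gaps_eq lam i (pred2 i.+1 i.-1) 2.
Proof.
move=> iN; have ci : c i = c N by apply: level_const; lia.
apply: gaps_exact; [by apply: not_neighbour; lia|exact: gaps2|by rewrite -/(c i) ci|].
rewrite neighbours; last by lia.
by rewrite -/(c i) ci !level_const; lia.
Qed.

End LevelCounts.

Section BraidGaps.
Variables (S : finType) (M : coxMatrix S).
Implicit Types (s t : S) (b x y : seq S).

(** Between two cyclically consecutive occurrences of [s] there are at least two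
    letters that do not commute with [s], if all such letters [t] have
    [M s t = 3]: otherwise [s s] or [s t s] appears after commutations. *)
Lemma braid_free_gap s b x : braid_free M (s :: b ++ s :: x) ->
    (forall t, t \in b -> M s t != 2 -> M s t = 3) ->
  1 < count (fun t => M s t != 2) b.
Proof.
move=> bf b3; rewrite ltnNge; apply/negP => c1.
have all2 y : count (fun t => M s t != 2) y = 0 -> all (fun t => M s t == 2) y.
  move=> /eqP; rewrite -leqn0 leqNgt -has_count => /hasPn ny.
  by apply/allP => t /ny; rewrite negbK.
case: (posnP (count (fun t => M s t != 2) b)) => [/all2 b2|].
  exact: (bf b [:: s; s] x (Square M s) (commeq_move b2 _)).
rewrite -has_count => /hasP[t tb st]; have st3 := b3 t tb st.
case/splitPr: tb bf c1 {b3} => b1 b2 bf; rewrite count_cat /= st => c1.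
have /all2 b12 : count (fun t => M s t != 2) b1 = 0 by lia.
have /all2 b22 : count (fun t => M s t != 2) b2 = 0 by lia.
have fb : forbidden M [:: s; t; s].
  by have := @Braid _ M s t; rewrite st3; apply.
apply: (bf b1 [:: s; t; s] (b2 ++ x) fb).
rewrite -catA; apply: (commeq_trans (commeq_move b12 _)).
have := commeq_ctx (b1 ++ [:: s; t]) [::] (commeq_sym (commeq_move b22 x)).
by rewrite !cats0 -!catA.
Qed.

(** A braid word of length 4 comes out of two occurrences of [s] and two of [t]
    if the three stretches between them contain nothing else that fails to
    commute with the letter to be moved. *)
Lemma braid_free_gap4 s t b1 b2 b3 x :
    braid_free M (s :: b1 ++ t :: b2 ++ s :: b3 ++ t :: x) -> M s t = 4 ->
    all (fun r => M s r == 2) (b1 ++ b2) ->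
    all (fun r => M t r == 2) (b2 ++ b3) ->
  False.
Proof.
rewrite !all_cat => bf st /andP[sb1 sb2] /andP[tb2 tb3].
have fb : forbidden M [:: s; t; s; t].
  by have := @Braid _ M s t; rewrite st; apply.
apply: (bf (b1 ++ b2) [:: s; t; s; t] (b3 ++ x) fb).
have move_in u r b v : all (fun r' => M r r' == 2) b ->
    commeq M (u ++ r :: b ++ v) (u ++ b ++ r :: v).
  by move=> rb; have := commeq_ctx u [::] (commeq_move rb v); rewrite !cats0.
have := move_in [::] s b1 (t :: b2 ++ s :: b3 ++ t :: x) sb1.
have := move_in (b1 ++ [:: s]) t b2 (s :: b3 ++ t :: x) tb2.
have := move_in b1 s b2 (t :: s :: b3 ++ t :: x) sb2.
have := commeq_sym (move_in (b1 ++ b2 ++ [:: s; t; s]) t b3 x tb3).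
rewrite /= -!catA /= => e4 e3 e2 e1.
exact: commeq_trans e1 (commeq_trans e2 (commeq_trans e3 e4)).
Qed.

End BraidGaps.

(** * Classification of the cyclically braid-free words on a fork *)

Lemma map_eq_cat (A B : Type) (f : A -> B) y b1 b2 : map f y = b1 ++ b2 ->
  exists y1 y2, [/\ y = y1 ++ y2, map f y1 = b1 & map f y2 = b2].
Proof.
move=> e; exists (take (size b1) y), (drop (size b1) y).
by rewrite cat_take_drop map_take map_drop e take_size_cat // drop_size_cat.
Qed.

Lemma map_eq_cons (A B : Type) (f : A -> B) y a b : map f y = a :: b ->
  exists r y', [/\ y = r :: y', f r = a & map f y' = b].
Proof. by case: y => //= r y [<- <-]; exists r, y. Qed.

Section ForkWords.
Variable m : nat.
Local Notation n := m.+2.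
Local Notation S := (fork n).
Implicit Types (s t r : S) (x y : seq S).

(** The distance to the branching end: [t_1] and [t_2] have level 0. *)
Definition lev s : nat := if s is inr i then i.+1 else 0.

Lemma lev_edge s t :
  fork_edge s t = ((lev s).+1 == lev t) || ((lev t).+1 == lev s).
Proof. by case: s t => [b|i] [c|j] //=; rewrite !eqSS // orbF. Qed.

Lemma lev_inj s t : 0 < lev s -> lev s = lev t -> s = t.
Proof. by case: s t => [b|i] [c|j] //= _ [/ord_inj ->]. Qed.

Lemma lev_le s : lev s <= n.
Proof. by case: s => [b|i] //=. Qed.

Definition node i : S := inr (inord i.-1).

Lemma lev_node i : 0 < i <= n -> lev (node i) = i.
Proof. by move=> i_n; rewrite /= inordK; lia. Qed.

Lemma count_lev s x : 0 < lev s ->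
  count_mem s x = level_count (map lev x) (lev s).
Proof.
move=> s0; rewrite /level_count count_map; apply: eq_count => r /=.
by apply/eqP/eqP => [->//|e]; rewrite (lev_inj s0 (esym e)).
Qed.

Definition tip (b : bool) : S := inl b.

Lemma count_ends x :
  count_mem (tip true) x + count_mem (tip false) x = level_count (map lev x) 0.
Proof.
by rewrite /level_count; elim: x => //= -[[]|i] x /= <-; lia.
Qed.

Section ForkMatrix.
Variable M : coxMatrix S.
Hypothesis M_edge : forall s t, (M s t != 2) = (s == t) || fork_edge s t.

(** The letters on these levels commute with [s].  For the last node, adjacency
    only concerns the level below, since level [n + 1] has no letters. *)
Definition far s i :=
  [&& i != lev s, (lev s == n) || (i != (lev s).+1) & i != (lev s).-1].

Lemma commute_lev s b : 0 < lev s -> all (far s) (map lev b) ->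
  all (fun r => M s r == 2) b.
Proof.
move=> s0; rewrite all_map; apply: sub_all => r /= /and3P[r1 r2 r3].
rewrite -[_ == 2]negbK M_edge lev_edge negb_or.
have -> : s != r by apply: contraNneq r1 => ->.
by have := lev_le r; lia.
Qed.

Variable x : seq S.
Hypothesis bf : cyc_braid_free M x.
Local Notation lam := (map lev x).
Local Notation c := (level_count lam).

Lemma level_gap s j b w : 0 < lev s ->
    (forall t, fork_edge s t -> lev t \in b -> M s t = 3) ->
    rot j lam = lev s :: b ++ lev s :: w -> lev s \notin b ->
  1 < count (pred2 (lev s).+1 (lev s).-1) b.
Proof.
move=> s0 s3; rewrite -map_rot => e sb.
have [r [y [ex rs ey]]] := map_eq_cons e.
have [b' [y' [ey' eb ew]]] := map_eq_cat ey.
have [r' [w' [ew' rs' _]]] := map_eq_cons ew.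
have er := lev_inj s0 (esym rs); have er' := lev_inj s0 (esym rs'); subst r r' y y'.
have snb : s \notin b' by apply: contra sb => sb; rewrite -eb map_f.
have := @braid_free_gap _ M s b' w'; rewrite -ex => /(_ (@bf j)) gap.
suff <- : count (fun t => M s t != 2) b' = count (pred2 (lev s).+1 (lev s).-1) b.
  apply: gap => t tb; rewrite M_edge; case: eqP => [st|_ /= /s3];
    first by rewrite st tb in snb.
  by apply; rewrite -eb map_f.
rewrite -eb count_map; apply: eq_in_count => t tb /=.
rewrite M_edge lev_edge; case: eqP => [st|_]; first by rewrite st tb in snb.
by lia.
Qed.

Lemma end_gaps b : M (tip b) (node 1) = 3 ->
  gaps_ge x (tip b) (pred1 (node 1)) 2.
Proof.
move=> b3 j g w e gb.
have := @braid_free_gap _ M (tip b) g w; rewrite -e => /(_ (@bf j)) gap.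
suff <- : count (fun t => M (tip b) t != 2) g = count (pred1 (node 1)) g.
  apply: gap => t tg; rewrite M_edge; case: eqP => [st|_ /=];
    first by rewrite st tg in gb.
  by case: t {tg} => [//|i] /= /eqP i0; rewrite -b3; congr (M _ (inr _));
    apply/ord_inj; rewrite inordK.
apply: eq_in_count => t tg /=.
rewrite M_edge; case: eqP => [st|_ /=]; first by rewrite st tg in gb.
case: t {tg} => [//|i] /=; apply/eqP/eqP => [i0|[->]]; last by rewrite inordK.
by congr inr; apply/ord_inj; rewrite inordK.
Qed.

Section Ends.
Hypothesis ends3 : forall b, M (tip b) (node 1) = 3.

Lemma end_sum b : 1 < count_mem (tip b) x -> 2 * count_mem (tip b) x <= c 1.
Proof.
move=> b2; have := gaps_sum _ (end_gaps (ends3 b)) b2.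
by rewrite [count _ _ as X in _ -> is_true (_ <= X)]count_lev ?lev_node //; apply.
Qed.

Lemma ends_le b : 1 < c 1 -> 2 * count_mem (tip b) x <= c 1.
Proof.
move=> c1; have [b1|] := leqP (count_mem (tip b) x) 1; last exact: end_sum.
by lia.
Qed.

Lemma level01 : 1 < c 1 -> c 0 <= c 1.
Proof.
by move=> c1; have := ends_le true c1; have := ends_le false c1;
  rewrite -count_ends; lia.
Qed.

Lemma node_gaps i : 0 < i <= n ->
    (forall t, fork_edge (node i) t -> M (node i) t = 3) ->
  gaps_ge lam i (pred2 i.+1 i.-1) 2.
Proof.
move=> iN i3 j b w; have li := lev_node iN;
  rewrite -[X in X :: _]li -[X in _ ++ X :: _]li.
move=> e ib; have := level_gap _ _ e; rewrite li; apply; [lia|by move=> t /i3|by []].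
Qed.

(** The repeated letters spread towards the other end of the fork. *)
Lemma repeated_climb N s : 0 < N ->
    (forall i, 0 < i < N -> gaps_ge lam i (pred2 i.+1 i.-1) 2) ->
    1 < count_mem s x -> lev s <= N ->
  1 < c N.
Proof.
move=> N0 gaps s2 sN; have c01 := level01.
have [s0|s0] := posnP (lev s); last first.
  by apply: (level_climb c01 gaps (i := lev s)); rewrite -?count_lev // s0.
apply: (level_climb c01 gaps (i := 1)) => //.
have [b sb] : exists b, s = tip b by case: (s) s0 => [b|//]; exists b.
by move: s2; rewrite sb => s2; have := end_sum s2; lia.
Qed.

End Ends.
End ForkMatrix.

Lemma not_uniq_repeated x : ~~ uniq x -> exists s, 1 < count_mem s x.
Proof.
elim: x => //= s x IH; rewrite negb_and negbK => /orP[sx|/IH[t tx]].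
  by exists s; rewrite eqxx add1n ltnS -has_count has_pred1.
by exists t; apply: leq_trans tx _; apply: leq_addl.
Qed.

Lemma D_commute s t : (D_matrix n s t != 2) = (s == t) || fork_edge s t.
Proof.
rewrite -[D_matrix n s t]/(D_m s t) /D_m.
by case: (s == t) => //; case: (fork_edge s t).
Qed.

Lemma affB_commute s t : (affB_matrix n s t != 2) = (s == t) || fork_edge s t.
Proof.
rewrite -[affB_matrix n s t]/(affB_m s t) /affB_m.
by case: (s == t) => //; case: (fork_edge s t) => //; case: ifP.
Qed.

Lemma fork_edge_irr s : fork_edge s s = false.
Proof. by rewrite lev_edge; lia. Qed.

Lemma D_edge3 s t : fork_edge s t -> D_matrix n s t = 3.
Proof.
rewrite -[D_matrix n s t]/(D_m s t) /D_m.
by have [->|_ ->] := eqVneq s t; rewrite ?fork_edge_irr.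
Qed.

Lemma fork_end_lev s : fork_end s = (lev s == n).
Proof. by case: s. Qed.

Lemma affB_edge s t : fork_edge s t ->
  affB_matrix n s t = if (lev s == n) || (lev t == n) then 4 else 3.
Proof.
rewrite -[affB_matrix n s t]/(affB_m s t) /affB_m !fork_end_lev.
by have [->|_ ->] := eqVneq s t; rewrite ?fork_edge_irr.
Qed.

Lemma tip_edge b : fork_edge (tip b) (node 1).
Proof. by rewrite lev_edge lev_node. Qed.

(** In [D_(n+2)] the letter counts would increase beyond the end of the fork. *)
Lemma D_uniq x : cyc_braid_free (D_matrix n) x -> uniq x.
Proof.
move=> bf; apply: contraT => /not_uniq_repeated[s s2].
suff : 1 < level_count (map lev x) n.+1.
  rewrite /level_count (count_memPn _) //; apply/mapP => -[r _ e].
  by have := lev_le r; rewrite -e ltnn.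
have ends3 b := D_edge3 (tip_edge b).
apply: (repeated_climb D_commute bf ends3 _ _ s2) => //; last first.
  exact: leq_trans (lev_le s) _.
by move=> i iN; apply: (node_gaps D_commute bf) => // t; apply: D_edge3.
Qed.

End ForkWords.

(** ** The edge labelled 4 *)

Section AffB.
Variable m : nat.
Local Notation n := m.+2.
Local Notation S := (fork n).
Local Notation M := (affB_matrix n).
Local Notation lev := (@lev m).
Local Notation node := (@node m).
Local Notation tip := (@tip m).
Local Notation N := m.+1.
Implicit Types (s t r : S) (x y : seq S).

(** The tips share level 0, so this word does not show their relative order;
    [tip_pair] keeps track of each of them separately. *)
Definition level_pair i x := filter (pred2 i i.+1) (map lev x).
Definition tip_pair b x := filter (pred2 (tip b) (node 1)) x.

Definition alternating_word k x : Prop :=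
  (forall i, i < n -> alternating (2 * k) i i.+1 (level_pair i x)) /\
  forall b, triple_word k (tip b) (node 1) (tip_pair b x).

(** A zigzag word cut just before a letter [u], which has level [n]. *)
Definition zigzag_start k x : Prop :=
  [/\ level_pair N x = flatten (nseq k [:: n; N; N]),
      forall i, i < N -> level_pair i x = flatten (nseq k [:: i.+1; i; i; i.+1])
    & forall b, triple_word k (tip b) (node 1) (tip_pair b x)].

Section Gaps.
Variable x : seq S.
Hypothesis bf : cyc_braid_free M x.
Local Notation lam := (map lev x).
Local Notation c := (level_count lam).

Let ends3 b : M (tip b) (node 1) = 3.
Proof. by rewrite affB_edge ?tip_edge // lev_node. Qed.

Let inner3 s t : 0 < lev s < N -> fork_edge s t -> M s t = 3.
Proof. by move=> sN st; rewrite affB_edge //; move: st; rewrite lev_edge;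
  case: ifP => //; lia. Qed.

Let inner_gaps i : 0 < i < N -> gaps_ge lam i (pred2 i.+1 i.-1) 2.
Proof.
move=> iN; apply: (node_gaps (@affB_commute m) bf) => [|t]; first by lia.
by apply: inner3; rewrite lev_node; lia.
Qed.

Let top_gaps : gaps_ge lam n (pred1 N) 1.
Proof.
move=> j b w; rewrite -map_rot => e nb.
have [r [y [ex rs ey]]] := map_eq_cons e.
have [b' [y' [ey' eb ew]]] := map_eq_cat ey.
have [r' [w' [ew' rs' _]]] := map_eq_cons ew.
have er : r' = r by apply: lev_inj; rewrite rs'.
subst r' y y'; rewrite lt0n; apply/negP => /eqP Nb.
have b2 : all (fun q => M r q == 2) b'.
  apply: (commute_lev (@affB_commute m)); first by rewrite rs.
  rewrite eb; apply/allP => i ib; rewrite /far rs eqxx /=.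
  have -> /= : i != n by apply: contraNneq nb => <-.
  apply: contraPneq Nb => <-; apply/eqP; rewrite -lt0n -has_count.
  by rewrite has_pred1.
have := @bf j; rewrite ex => /(_ b' [:: r; r] w'); apply; first exact: Square.
exact: commeq_move.
Qed.

Let level_gap4 s t j b1 b2 b3 w : 0 < lev s -> 0 < lev t -> M s t = 4 ->
    rot j lam = lev s :: b1 ++ lev t :: b2 ++ lev s :: b3 ++ lev t :: w ->
    all (far s) (b1 ++ b2) -> all (far t) (b2 ++ b3) ->
  False.
Proof.
move=> s0 t0 st; rewrite -map_rot => e.
have [s1 [y [ex es1 e1]]] := map_eq_cons e.
have [b1' [y1 [ey1 <- e2]]] := map_eq_cat e1.
have [t1 [y2 [ey2 et1 e3]]] := map_eq_cons e2.
have [b2' [y3 [ey3 <- e4]]] := map_eq_cat e3.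
have [s2 [y4 [ey4 es2 e5]]] := map_eq_cons e4.
have [b3' [y5 [ey5 <- e6]]] := map_eq_cat e5.
have [t2 [w' [ey6 et2 _]]] := map_eq_cons e6.
have ? := lev_inj s0 (esym es1); have ? := lev_inj s0 (esym es2).
have ? := lev_inj t0 (esym et1); have ? := lev_inj t0 (esym et2); subst.
rewrite -!map_cat => sb tb.
apply: (@braid_free_gap4 _ M _ _ b1' b2' b3' w' _ st).
- by rewrite -ex; apply: bf.
- exact: (commute_lev (@affB_commute m)).
- exact: (commute_lev (@affB_commute m)).
Qed.

Lemma affB_repeated_climb : ~~ uniq x -> 1 < c N.
Proof.
move=> /not_uniq_repeated[s s2].
have [sN|sN] := leqP (lev s) N.
  exact: (repeated_climb (@affB_commute m) bf ends3 _ inner_gaps s2).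
have ls : lev s = n by apply/eqP; rewrite eqn_leq sN lev_le.
have cn : 1 < c n by move: s2; rewrite count_lev ls.
have Nn : ~~ pred1 N n by rewrite /=; lia.
have := gaps_sum Nn top_gaps cn; rewrite mul1n; exact: leq_trans.
Qed.

Section Middle.
Variables (j : nat) (gs : seq (seq nat)).
Hypotheses (gs2 : 1 < size gs) (e : rot j lam = join_gaps N gs).
Hypothesis Ngs : all (fun b => N \notin b) gs.

Definition gap_type (b : seq nat) := (count_mem n b, count_mem m b).

Let split_top b : 0 < count_mem n b -> exists b1 b2,
  [/\ b = b1 ++ n :: b2, n \notin b1 & count_mem n b = (count_mem n b2).+1].
Proof.
have [b1 [bs [-> nb1]]] := join_gapsP n b; case: bs => [|b2 bs].
  by rewrite cats0 (count_memPn nb1).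
exists b1, (b2 ++ join_gaps n bs); split=> //.
by rewrite count_cat (count_memPn nb1) /= eqxx.
Qed.

(** Two letters [u] without [v] between them could be brought together, and in
    the absence of [u] the edge labelled 4 gives no exception. *)
Lemma middle_ok : all gap_ok (map gap_type gs).
Proof.
rewrite all_map; apply/allP => b bgs; have Nb := allP Ngs b bgs.
have [i [w ei]] : exists i w, rot i lam = N :: b ++ N :: w.
  case/splitPr: bgs e gs2 => gs1 gs3 e' sz; apply: (join_gaps_gap e').
  by move: sz; rewrite !size_cat /=; lia.
rewrite /gap_ok /=; apply/andP; split.
  rewrite leqNgt; apply/negP => c2; have [|b1 [b2 [eb nb1 c1]]] := @split_top b.
    exact: leq_trans c2.
  have [|b3 [b4 [eb2 nb3 _]]] := @split_top b2; first by rewrite c1 ltnS in c2.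
  have [k ek] := rot_rotE (size (N :: b1)) i lam.
  have : rot k lam = n :: b3 ++ n :: (b4 ++ N :: w ++ N :: b1).
    rewrite -ek ei eb eb2 -cat_cons -!catA -cat_cons rot_size_cat /=.
    by rewrite -!catA /= -!catA.
  move=> /top_gaps/(_ nb3); rewrite -has_count has_pred1 => Nb3.
  by move: Nb; rewrite eb eb2 !mem_cat inE mem_cat Nb3 !orbT.
apply/implyP => /eqP n0.
have := @level_gap _ _ (@affB_commute m) _ bf (node N) i b w.
rewrite lev_node; last by lia.
rewrite ei => /(_ isT _ erefl Nb).
rewrite (count_pred2 b (_ : N.+1 != N.-1)) ?n0; last by lia.
apply=> t; rewrite lev_edge lev_node; last by lia.
move=> Nt tb; rewrite affB_edge ?lev_edge ?lev_node //; try lia.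
case: ifP => // /orP[|/eqP tn]; first by lia.
by move: n0; apply/contra_eq; rewrite -lt0n -has_count has_pred1 -tn.
Qed.

(** A gap reduced to [u], between two letters [v], and a second [u] in an
    adjacent gap form [v u v u] or [u v u v]. *)
Lemma middle_next : cycle gap_next (map gap_type gs).
Proof.
apply: cycle_rotP => [|i]; first by rewrite size_map.
move=> [p q] [p' q'] gs'; rewrite -map_rot => ei.
have [b [gs1 [egs eb ei1]]] := map_eq_cons ei.
have [b' [q1 [eq1 eb' _]]] := map_eq_cons ei1; subst gs1.
have [k ek] := join_gaps_rot_gaps i e; rewrite egs in ek.
have : all gap_ok (map gap_type (rot i gs)).
  have := middle_ok; rewrite !all_map => ok; apply/allP => g; rewrite mem_rot.
  exact: (allP ok).
have : all (fun b => N \notin b) (rot i gs).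
  by apply/allP => g; rewrite mem_rot; apply: (allP Ngs).
rewrite egs /= -eb -eb' => /and3P[Nb Nb' _] /and3P[/andP[/= le1 _] /andP[/=
  le1' _] _].
have lN : lev (node N) = N by apply: lev_node; lia.
have ln : lev (node n) = n by apply: lev_node; lia.
have MN : M (node N) (node n) = 4.
  by rewrite affB_edge ?lev_edge ?lN ?ln ?eqxx ?orbT.
have Mn : M (node n) (node N) = 4 by rewrite cox_m_sym.
have notin (r : nat) g : count_mem r g = 0 -> r \notin g by move=> /count_memPn.
apply/andP; split; apply/implyP => /eqP[n1 m0]; rewrite eqn0Ngt; apply/negP => n1'.
  have [|b1 [b2 [bE nb1 nb]]] := @split_top b; first by rewrite n1.
  have [h1 [h2 [b'E nh1 _]]] := split_top n1'.
  have nb2 : n \notin b2.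
  by apply: notin; apply/eqP; rewrite -leqn0 -ltnS -nb.
  have mb : m \notin b by apply: notin.
  apply: (@level_gap4 (node N) (node n) k b1 b2 h1 (h2 ++ join_gaps N q1)).
  - by rewrite lN.
  - by rewrite ln.
  - by [].
  - by rewrite lN ln ek !join_gaps_cons bE b'E -!catA.
  - apply/allP => r rb; rewrite /far lN /=.
    have rb' : r \in b.
      by move: rb; rewrite bE !mem_cat inE => /orP[] ->; rewrite ?orbT.
    have -> : r != N by apply: contraNneq Nb => <-.
    have -> : r != m by apply: contraNneq mb => <-.
    have -> : r != n by apply: contraTneq rb => ->; rewrite mem_cat negb_or nb1.
    by rewrite orbT.
  - apply/allP => r rb; rewrite /far ln eqxx /=.
    have -> : r != n by apply: contraTneq rb => ->; rewrite mem_cat negb_or nb2.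
    apply: contraTneq rb => ->; rewrite mem_cat negb_or.
    move: Nb Nb'; rewrite bE b'E !mem_cat !inE !negb_or.
    by move=> /and3P[_ _ ->] /and3P[-> _ _].
have [b1 [b2 [bE nb1 nb]]] := split_top n1'.
have [|h1 [h2 [b'E nh1 nb']]] := @split_top b'; first by rewrite n1.
have nh2 : n \notin h2.
  by apply: notin; apply/eqP; rewrite -leqn0 -ltnS -nb'.
have nb2 : n \notin b2.
  by apply: notin; apply/eqP; rewrite -leqn0 -ltnS -nb.
have mb' : m \notin b' by apply: notin.
have [k' ek'] := rot_rotE (size (N :: b1)) k lam.
have [w ew] : exists w, rot k' lam = n :: b2 ++ N :: h1 ++ n :: h2 ++ N :: w.
  move: ek'; rewrite ek !join_gaps_cons bE b'E -!catA -cat_cons rot_size_cat.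
  case: q1 {egs ek ei1} => [|q2 q1] <-.
    by exists b1; rewrite !(cat_cons, =^~ catA).
  exists (q2 ++ join_gaps N q1 ++ N :: b1).
  by rewrite join_gaps_cons !(cat_cons, =^~ catA).
apply: (@level_gap4 (node n) (node N) k' b2 h1 h2 w).
- by rewrite ln.
- by rewrite lN.
- by [].
- by rewrite lN ln ew.
- apply/allP => r rb; rewrite /far ln eqxx /=.
  have -> : r != n by apply: contraTneq rb => ->; rewrite mem_cat negb_or nb2.
  apply: contraTneq rb => ->; rewrite mem_cat negb_or.
  move: Nb Nb'; rewrite bE b'E !mem_cat !inE !negb_or.
  by move=> /and3P[_ _ ->] /and3P[-> _ _].
- apply/allP => r rb; rewrite /far lN /=.
  have rb' : r \in b'.
    by move: rb; rewrite b'E !mem_cat inE => /orP[] ->; rewrite ?orbT.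
  have -> : r != N by apply: contraNneq Nb' => <-.
  have -> : r != m by apply: contraNneq mb' => <-.
  have -> : r != n by apply: contraTneq rb => ->; rewrite mem_cat negb_or nh1.
  by rewrite orbT.
Qed.

Lemma sum_gap_types : size gs = c N /\ sumn (map snd (map gap_type gs)) = c m.
Proof.
split; first by rewrite /level_count -(count_rot _ j) e count_mem_join_gaps.
rewrite /level_count -(count_rot _ j) e count_join_gaps -map_comp.
by have -> : pred1 m N = false by rewrite /= gtn_eqF.
Qed.

End Middle.

Let c01 : 1 < c 1 -> c 0 <= c 1.
Proof. exact: (level01 (@affB_commute m) bf ends3). Qed.

Section Balanced.
Variable k : nat.
Hypotheses (k0 : 0 < k) (cN : c N = 2 * k) (cm : c m = c N).

Let cN1 : 1 < c N. Proof. by rewrite cN; lia. Qed.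

Let balanced i : i <= N -> c i = 2 * k.
Proof. by move=> iN; rewrite -cN; apply: (level_const c01 inner_gaps). Qed.

Let balanced_gaps i : 0 < i < N -> gaps_eq lam i (pred2 i.+1 i.-1) 2.
Proof. exact: (level_gaps c01 inner_gaps). Qed.

(** The two tips share the [2 k] letters of level 0 and each occurs at most [k]
    times, so that the gaps of each tip contain exactly two letters [s_1]. *)
Lemma tip_triple b i : triple_word k (tip b) (node 1) (tip_pair b (rot i x)).
Proof.
have c1 : count_mem (node 1) x = 2 * k.
  by rewrite count_lev lev_node ?balanced.
have ct b' : count_mem (tip b') x = k.
  have le b2 : 2 * count_mem (tip b2) x <= 2 * k.
    rewrite -(balanced (i := 1)) //.
    by apply: (ends_le (@affB_commute m) bf ends3); rewrite balanced //; lia.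
  have := count_ends x; rewrite balanced // => sum2.
  by have := le true; have := le false; case: b'; lia.
apply: filter_rot_closed => [y|]; first exact: triple_word_rot1.
apply: triple_gaps => //.
have nt : ~~ pred1 (node 1) (tip b) by [].
have [kgt|k1] := ltnP 1 k.
  apply: gaps_exact => //; first exact: (end_gaps (@affB_commute m) bf).
  - by rewrite ct.
  - by rewrite c1 ct.
have {}k1 : k = 1 by lia.
move=> j bs e sbs; have sz := count_mem_join_gaps sbs.
rewrite -e count_rot ct k1 in sz; case: bs sz e {sbs} => [|b' []] // _ e.
move: c1; rewrite -(count_rot _ j) e k1 count_join_gaps (negPf nt) /= addn0
  mul0n add0n.
by move=> ->.
Qed.

Lemma alternating_descend i : i <= m ->
  alternating (2 * k) m N (level_pair m x) ->
  alternating (2 * k) i i.+1 (level_pair i x).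
Proof.
move: {2}(m - i) (erefl (m - i)) => d; elim: d i => [|d IH] i dE im alt_m.
  by have -> : i = m by lia.
have im' : i.+1 <= m by lia.
have /(_ _ im' alt_m) alt_i := IH i.+1 (_ : m - i.+1 = d).
rewrite /level_pair (eq_filter (pred2C i i.+1)).
apply: (@alternating_transfer _ (2 * k) lam i.+1 i.+2 i); try lia.
  by apply: (balanced_gaps (i := i.+1)); lia.
by apply: alt_i; lia.
Qed.

Lemma zigzag_descend j i : i <= m ->
  level_pair m (rot j x) = flatten (nseq k [:: N; m; m; N]) ->
  level_pair i (rot j x) = flatten (nseq k [:: i.+1; i; i; i.+1]).
Proof.
move: {2}(m - i) (erefl (m - i)) => d; elim: d i => [|d IH] i dE im zig_m.
  by have -> : i = m by lia.
rewrite /level_pair (eq_filter (pred2C i i.+1)).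
apply: (@zigzag_transfer _ k _ i.+1 i.+2 i); try lia.
  by rewrite map_rot; apply/gaps_eq_rot/(balanced_gaps (i := i.+1)); lia.
by apply: IH => //; lia.
Qed.

End Balanced.

Let even_count : 1 < c N -> c m = c N -> exists k, c N = 2 * k.
Proof.
move=> cN cm; exists (count_mem (tip true) x).
have c_N i : i <= N -> c i = c N by apply: (level_const c01 inner_gaps).
have le b : 2 * count_mem (tip b) x <= c N.
  rewrite -(c_N 1) //.
  by apply: (ends_le (@affB_commute m) bf ends3); rewrite c_N.
have := count_ends x; rewrite c_N //.
by have := le true; have := le false; lia.
Qed.

(** The gaps around the last node before the edge labelled 4 decide between the
    two families. *)
Lemma affB_families : ~~ uniq x -> exists2 k, 0 < k &
  alternating_word k x \/ exists j, zigzag_start k (rot j x).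
Proof.
move=> /affB_repeated_climb c1.
have [|j [gs [e Ngs]]] := @join_gaps_rot _ N lam; first exact: ltnW.
have [sz sum] := sum_gap_types e Ngs.
have gs2 : 1 < size gs by rewrite sz.
have le : c m <= c N by apply: (level_mono c01 inner_gaps (i := N)); rewrite ?leqnn.
have [|all1|[i [k types]]] :=
    gap_cycle (middle_next gs2 e Ngs) (middle_ok gs2 e Ngs).
- by rewrite sum size_map sz.
- have types1 : map gap_type gs = nseq (c N) (1, 1).
    by rewrite -sz -(size_map gap_type); apply/all_pred1P.
  have cm : c m = c N.
    by rewrite -sum types1 map_nseq sumn_nseq mul1n.
  have [k cN] := even_count c1 cm.
  have k0 : 0 < k by lia.
  have count1 a : a = n \/ a = m -> map (count_mem a) gs = nseq (2 * k) 1.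
    move=> an; rewrite -cN; case: an => ->.
      by have := congr1 (map fst) types1; rewrite -map_comp map_nseq.
    by have := congr1 (map snd) types1; rewrite -map_comp map_nseq.
  have alt a : a = n \/ a = m -> alternating (2 * k) N a (filter (pred2 N a) lam).
    move=> an; have [l <-] := rot_back j lam.
    apply: filter_rot_closed => [y|]; first exact: alternating_rot1.
    have := @filter_pred2_join_gaps _ N a [::] gs isT Ngs.
    by rewrite e /= => ->; rewrite count1 // comb_1; left.
  exists k => //; left; split=> [i|b]; last first.
    by have := tip_triple k0 cN cm b 0; rewrite rot0.
  rewrite ltnS leq_eqVlt => /orP[/eqP ->|im]; first by apply: alt; left.
  apply: (alternating_descend k0 cN cm) => //.
  by rewrite /level_pair (eq_filter (pred2C m N)); apply/alternatingC/alt; right.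
have [l el] := join_gaps_rot_gaps i e.
have Ngs' : all (fun b => N \notin b) (rot i gs).
  by apply/allP => g; rewrite mem_rot; apply: (allP Ngs).
have types' : map gap_type (rot i gs) = flatten (nseq k [:: (1, 0); (0, 2)]).
  by rewrite map_rot.
have [sz' sum'] := sum_gap_types el Ngs'.
have cN : c N = 2 * k.
  by rewrite -sz' -(size_map gap_type) types' size_flatten /shape map_nseq sumn_nseq.
have cm : c m = c N.
  by rewrite -sum' types' map_flatten map_nseq sumn_flatten map_nseq sumn_nseq cN.
have k0 : 0 < k by lia.
exists k => //; right.
have [g [q egs]] : exists g q, rot i gs = g :: q.
  by case E: (rot i gs) types' => [|g q] types'; [case: (k) k0 types'|exists g, q].
rewrite egs in types' Ngs' el *; have /andP[Ng _] := Ngs'.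
have [n1 m0] : count_mem n g = 1 /\ count_mem m g = 0.
  by case: (k) k0 types' => //= k' _ [-> ->].
have ng : n \in g by rewrite -has_pred1 has_count n1.
case/splitPr: ng n1 m0 Ng types' Ngs' el {egs} => g1 g2 n1 m0 Ng types' Ngs' el.
(* The cut is moved to the letter [u] of a gap that consists of [u] only. *)
have [l' el'] := rot_rotE (size (N :: g1)) l lam.
have far_g1 a : a = n \/ a = m -> filter (pred2 N a) (N :: g1) = [:: N].
  move=> an; rewrite /= eqxx filter_pred2_gap; last first.
    by apply: contra Ng => g1N; rewrite mem_cat g1N.
  rewrite (_ : count_mem a g1 = 0) //.
  by case: an => ->; move: n1 m0; rewrite !count_cat /= ?eqxx; lia.
have start a : a = n \/ a = m -> filter (pred2 N a) (map lev (rot l' x))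
    = rot 1 (comb N a (map (count_mem a) ((g1 ++ n :: g2) :: q))).
  move=> an; have gE : join_gaps N ((g1 ++ n :: g2) :: q)
      = (N :: g1) ++ (n :: g2 ++ join_gaps N q).
    by rewrite join_gaps_cons -catA.
  rewrite map_rot -el' el gE rot_size_cat.
  rewrite -[comb _ _ _](@filter_pred2_join_gaps _ N a [::] _ isT Ngs').
  rewrite cat0s gE !filter_cat far_g1 //.
  by rewrite [in RHS]cat1s rot1_cons cats1.
exists l'; split=> [|i' i'N|b].
- rewrite /level_pair start; last by left.
  have := congr1 (map fst) types'; rewrite -map_comp map_flatten map_nseq => ->.
  by rewrite comb_10 rot1_pow.
- apply: (zigzag_descend k0 cN cm) => //.
  rewrite /level_pair (eq_filter (pred2C m N)) start; last by right.
  have := congr1 (map snd) types'; rewrite -map_comp map_flatten map_nseq => ->.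
  by rewrite comb_02 rot1_pow.
- exact: tip_triple.
Qed.

End Gaps.
End AffB.

(** * The two infinite families *)

Section CfcFamily.
Variables (S : finType) (M : coxMatrix S) (F : seq S -> Prop).
Hypothesis F_commeq : forall x y, commeq M x y -> F x -> F y.
Hypothesis F_rot1 : forall x, F x -> F (rot 1 x).
Hypothesis F_forbidden : forall u f v, forbidden M f -> ~ F (u ++ f ++ v).

Lemma family_cfc_word x : F x -> cfc_word M x.
Proof.
move=> Fx y xy i u f v ff yf; apply: (F_forbidden (u := u) (v := v) ff).
apply: (F_commeq yf); apply: rot1_ind => //; exact: F_commeq xy Fx.
Qed.

End CfcFamily.

Lemma uniq_cfc_word (S : finType) (M : coxMatrix S) x : uniq x -> cfc_word M x.
Proof.
apply: (@family_cfc_word _ _ (fun y : seq S => uniq y)) => [y z yz|y|u f v ff].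
- by rewrite (perm_uniq (commeq_perm yz)).
- by rewrite rot_uniq.
rewrite !cat_uniq => /and3P[_ _ /andP[+ _]].
case: ff => [s|s t]; first by rewrite /= inE eqxx.
by case: (M s t) => [|[|[|k]]] //= _; rewrite !inE eqxx orbT.
Qed.

Section Powers.
Variable T : eqType.
Implicit Types (w : seq T).

Lemma size_pow k w : size (flatten (nseq k w)) = k * size w.
Proof. by rewrite size_flatten /shape map_nseq sumn_nseq mulnC. Qed.

Lemma nth_pow (d : T) k w i : i < k * size w ->
  nth d (flatten (nseq k w)) i = nth d w (i %% size w).
Proof.
elim: k i => // k IH i ik; rewrite flatten_nseqS nth_cat.
have [iw|wi] := ltnP i (size w); first by rewrite modn_small.
rewrite IH; last by lia.
by rewrite -{2}(subnK wi) modnDr.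
Qed.

Lemma pow_mkseq d k w :
  flatten (nseq k w) = mkseq (fun i => nth d w (i %% size w)) (k * size w).
Proof.
apply: (@eq_from_nth _ d); rewrite size_pow ?size_mkseq // => i ik.
by rewrite nth_pow // nth_mkseq.
Qed.

Lemma filter_pow p k w :
  filter p (flatten (nseq k w)) = flatten (nseq k (filter p w)).
Proof. by rewrite filter_flatten map_nseq. Qed.

Lemma map_pow (T' : Type) (f : T -> T') k w :
  map f (flatten (nseq k w)) = flatten (nseq k (map f w)).
Proof. by rewrite map_flatten map_nseq. Qed.

Lemma modn_succ (p d : nat) : 0 < d ->
  p.+1 %% d = if (p %% d).+1 == d then 0 else (p %% d).+1.
Proof.
move=> d0; rewrite -addn1 -modnDml addn1; case: eqP => [->|/eqP pd].
  by rewrite modnn.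
by rewrite modn_small //; have := ltn_pmod p d0; lia.
Qed.

Lemma nth_factor (d : T) u f v i : i < size f ->
  nth d (u ++ f ++ v) (size u + i) = nth d f i.
Proof.
by move=> i_f; rewrite nth_cat ltnNge leq_addr /= addKn nth_cat i_f.
Qed.

Lemma pow_factor (d : T) k w u f v i : flatten (nseq k w) = u ++ f ++ v ->
  i < size f ->
  nth d f i = nth d w ((size u + i) %% size w).
Proof.
move=> e i_f; rewrite -(nth_factor d u v i_f) -e nth_pow //.
by have := congr1 size e; rewrite size_pow !size_cat => ->; lia.
Qed.

Lemma alternating_no_square k s a w u c v : s != a -> alternating k s a w ->
  w <> u ++ [:: c; c] ++ v.
Proof.
move=> sa alt_w ew; subst w.
case: alt_w => /esym e; have := pow_factor s e (isT : 0 < 2);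
  have := pow_factor s e (isT : 1 < 2); rewrite /= addn0 addn1 modn_succ //=;
  case: (size u %% 2) (ltn_pmod (size u) (isT : 0 < 2)) => [|[|]] //= _ -> e2;
  by rewrite e2 eqxx in sa.
Qed.

Lemma triple_no_factor k s a w u f v : s != a -> triple_word k s a w ->
  f = [:: s; s] \/ f = [:: s; a; s] -> w <> u ++ f ++ v.
Proof.
move=> sa tr_w ef ew; subst w.
have szf : 1 < size f by case: ef => ->.
case: tr_w => /esym e; have := pow_factor s e (ltnW szf);
  have := pow_factor s e szf;
  have : 2 < size f -> _ := pow_factor s e;
  rewrite /= addn0 addn1 addn2 !modn_succ //=;
  case: (size u %% 3) (ltn_pmod (size u) (isT : 0 < 3)) => [|[|[|]]] //= _;
  case: ef => -> /=;
  try (by move=> _ e1 e2; subst; rewrite eqxx in sa);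
  try (by move=> /(_ isT) e1 e2 e3; subst; rewrite eqxx in sa).
Qed.

End Powers.

Section Families.
Variable m : nat.
Local Notation n := m.+2.
Local Notation S := (fork n).
Local Notation M := (affB_matrix n).
Local Notation lev := (@lev m).
Local Notation node := (@node m).
Local Notation tip := (@tip m).
Local Notation N := m.+1.
Implicit Types (s t r : S) (x y : seq S).
Local Notation level_pair := (@level_pair m).
Local Notation tip_pair := (@tip_pair m).
Local Notation L := (2 * n).+1.
Local Notation tip_triple k b x := (triple_word k (tip b) (node 1) (tip_pair b x)).

Lemma commuting_levels s t : M s t = 2 ->
  (lev s).+1 != lev t /\ (lev t).+1 != lev s.
Proof.
move=> st; have := affB_commute s t; rewrite st eqxx lev_edge => /esym/negbT.
by rewrite !negb_or => /and3P[].
Qed.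

Lemma level_pair_commeq i x y : commeq M x y -> level_pair i x = level_pair i y.
Proof.
apply: commeq_invariant => u v s t /commuting_levels[st ts].
rewrite /level_pair !map_cat !filter_cat /=; congr (_ ++ _).
case: ifP => si; case: ifP => ti //; congr [:: _, _ & _].
  by move: si ti => /orP[/eqP si|/eqP si] /orP[/eqP ti|/eqP ti]; lia.
by move: si ti => /orP[/eqP si|/eqP si] /orP[/eqP ti|/eqP ti]; lia.
Qed.

Lemma tip_pair_commeq b x y : commeq M x y -> tip_pair b x = tip_pair b y.
Proof. by apply: commeq_filter; rewrite affB_commute tip_edge orbT. Qed.

(** Every node lies on an edge, so the occurrences of a single letter are read
    off a projection to an edge; away from the tips, a letter is given by its
    level. *)
Lemma commeq_of_pairs x y :
    (forall i, 0 < i < n -> level_pair i x = level_pair i y) ->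
    (forall b, tip_pair b x = tip_pair b y) ->
  commeq M x y.
Proof.
move=> lev_xy tip_xy.
have edge s t : (lev s).+1 = lev t ->
    filter (pred2 s t) x = filter (pred2 s t) y.
  move=> st; have [s0|s0] := posnP (lev s).
    have -> : t = node 1.
      by apply: lev_inj; rewrite -st ?s0 // lev_node.
    have [b ->] : exists b, s = tip b by case: (s) s0 => [b _|//]; exists b.
    exact: tip_xy.
  have pairE z : map lev (filter (pred2 s t) z) = level_pair (lev s) z.
    rewrite /level_pair filter_map; congr map; apply: eq_filter => r /=.
    have t0 : 0 < lev t by rewrite -st.
    rewrite st; congr orb; apply/eqP/eqP => [->//|e].
      by rewrite (lev_inj s0 (esym e)).
    by rewrite (lev_inj t0 (esym e)).
  apply: (@inj_in_map _ _ lev (pred2 s t)); first last.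
  - by rewrite !pairE; apply: lev_xy; have := lev_le t; lia.
  - by apply/allP => r; rewrite mem_filter => /andP[].
  - by apply/allP => r; rewrite mem_filter => /andP[].
  move=> r r' /orP[]/eqP -> /orP[]/eqP -> //; lia.
apply: commeq_filterP => s t; rewrite affB_commute lev_edge.
case/orP => [/eqP <-|/orP[/eqP|/eqP /edge]]; last first.
- by rewrite (eq_filter (pred2C t s)) [in RHS](eq_filter (pred2C t s)).
- exact: edge.
have [r [t' [sr e]]] : exists r t', (s == r) || (s == t') /\ (lev r).+1 = lev t'.
  have [sn|sn] := eqVneq (lev s) n.
    by exists (node N), s; rewrite eqxx orbT lev_node ?sn //; lia.
  exists s, (node (lev s).+1); rewrite eqxx lev_node //.
  by have := lev_le s; lia.
have sub z : filter (pred2 s s) z = filter (pred1 s) (filter (pred2 r t') z).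
  rewrite -filter_predI; apply: eq_filter => q /=; rewrite orbb.
  by case: eqP => [->|].
by rewrite !sub (edge _ _ e).
Qed.

Lemma alternating_word_commeq k x y :
  commeq M x y -> alternating_word k x -> alternating_word k y.
Proof.
move=> xy [lx tx]; split=> [i iN|b];
  first by rewrite -(level_pair_commeq i xy); apply: lx.
by rewrite -(tip_pair_commeq b xy).
Qed.

Lemma tip_triple_rot1 k b x : tip_triple k b x -> tip_triple k b (rot 1 x).
Proof.
by move=> tx; apply: filter_rot_closed => [y|]; first exact: triple_word_rot1.
Qed.

Lemma alternating_word_rot1 k x : alternating_word k x ->
  alternating_word k (rot 1 x).
Proof.
case=> lx tx; split=> [i iN|b]; last exact: tip_triple_rot1.
rewrite /level_pair map_rot; apply: filter_rot_closed => [y|]; last exact: lx.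
exact: alternating_rot1.
Qed.

Lemma forbidden_affB f : forbidden M f -> (exists s, f = [:: s; s]) \/
  exists s t, fork_edge s t /\
    (f = [:: s; t; s] /\ lev s < n /\ lev t < n \/
     f = [:: s; t; s; t] /\ ((lev s == n) || (lev t == n))).
Proof.
case=> [s|s t st]; [by left; exists s|right; exists s, t].
have st_edge : fork_edge s t.
  have := affB_commute s t; rewrite gtn_eqF // => /esym/orP[/eqP e|//].
  by move: st; rewrite -e (eqP (_ : M s s == 1)) ?cox_m_diag.
split=> //; rewrite affB_edge //; case: ifP => st_n; [right|left] => //.
by move/negbT: st_n; rewrite negb_or => /andP[sn tn]; have := lev_le s; have :=
  lev_le t; do 2?split=> //; lia.
Qed.

Lemma level_pair_factor i u f v : level_pair i (u ++ f ++ v)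
  = level_pair i u ++ level_pair i f ++ level_pair i v.
Proof. by rewrite /level_pair !map_cat !filter_cat. Qed.

Lemma tip_pair_factor b u f v : tip_pair b (u ++ f ++ v)
  = tip_pair b u ++ tip_pair b f ++ tip_pair b v.
Proof. by rewrite /tip_pair !filter_cat. Qed.

(** The two letters [s] are consecutive in the projection to the other edge at
    [s]; if [s] is a tip, only one letter [s_1] separates them. *)
Lemma alternating_word_braid k u s t v : fork_edge s t -> lev s < n ->
  ~ alternating_word k (u ++ [:: s; t; s] ++ v).
Proof.
rewrite lev_edge => st sn [lx tx]; case/orP: st => /eqP st; last first.
  apply: (@alternating_no_square _ _ (lev s) (lev s).+1 _ (level_pair (lev s) u)
    (lev s) (level_pair (lev s) v) _ (lx _ sn)); first by lia.
  rewrite level_pair_factor {2}/level_pair /= eqxx /=.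
  by rewrite (_ : (lev t == lev s) || _ = false) //; lia.
have [s0|s0] := posnP (lev s).
  have et : t = node 1 by apply: lev_inj; rewrite -st ?s0 // lev_node.
  have [b es] : exists b, s = tip b by case: (s) s0 => [b _|//]; exists b.
  subst s t.
  apply: (@triple_no_factor _ _ (tip b) (node 1) _ (tip_pair b u)
    [:: tip b; node 1; tip b] (tip_pair b v) _ (tx b)) => //; first by right.
  by rewrite tip_pair_factor {2}/tip_pair /= !eqxx ?orbT.
have pn : (lev s).-1 < n by lia.
apply: (@alternating_no_square _ _ (lev s).-1 (lev s).-1.+1 _
  (level_pair (lev s).-1 u) (lev s) (level_pair (lev s).-1 v) _ (lx _ pn)).
  by lia.
rewrite level_pair_factor {2}/level_pair /= prednK // eqxx orbT.
by rewrite (_ : (lev t == _) || _ = false) //; lia.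
Qed.

Lemma alternating_word_forbidden k u f v :
  forbidden M f -> ~ alternating_word k (u ++ f ++ v).
Proof.
move=> /forbidden_affB[[s ->] [lx _]|[s [t [st [[-> [sn _]]|[-> stn]]]]]]; last first.
- have [sn|sn] := ltnP (lev s) n.
    rewrite -[[:: s; t; s; t]]/([:: s; t; s] ++ [:: t]) -catA.
    exact: alternating_word_braid.
  rewrite -[[:: s; t; s; t]]/([:: s] ++ [:: t; s; t]) -catA catA.
  apply: alternating_word_braid; first by rewrite fork_edge_sym.
  by move: st; rewrite lev_edge; have := lev_le t; have := lev_le s; lia.
- exact: alternating_word_braid.
have [i [iN si]] : exists i, i < n /\ ((lev s == i) || (lev s == i.+1)).
  have := lev_le s; case: (lev s) => [|l] ln; first by exists 0.
  by exists l; rewrite eqxx orbT.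
apply: (@alternating_no_square _ _ i i.+1 _ (level_pair i u) (lev s)
  (level_pair i v) _ (lx _ iN)); first by lia.
by rewrite level_pair_factor {2}/level_pair /= si.
Qed.

Lemma alternating_cfc_word k x : alternating_word k x -> cfc_word M x.
Proof.
apply: (@family_cfc_word _ _ (@alternating_word m k)).
- exact: alternating_word_commeq.
- exact: alternating_word_rot1.
- by move=> u f v; apply: alternating_word_forbidden.
Qed.

(** ** The zigzag words *)

(** The level after [p] steps of the periodic walk along the fork, from its far
    end to the tips and back; level 0 occurs twice in a row because both tips
    are visited. *)
Definition zig p : nat := let q := p %% L in if q <= n then n - q else q - n.+1.

Definition zigzag_word k x : Prop :=
  (exists j, map lev x = mkseq (fun p => zig (p + j)) (k * L)) /\
  forall b, tip_triple k b x.

Lemma zig_mod p : zig (p %% L) = zig p.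
Proof. by rewrite /zig modn_mod. Qed.

Lemma zig_period p k : zig (p + k * L) = zig p.
Proof. by rewrite /zig addnC modnMDl. Qed.

Lemma zig_succ p :
  [\/ zig p.+1 = (zig p).+1, zig p = (zig p.+1).+1 | zig p = 0 /\ zig p.+1 = 0].
Proof.
rewrite /zig modn_succ //; have := ltn_pmod p (isT : 0 < L).
case: eqP => [e _|ne lt].
  by apply: Or31; rewrite leq0n; case: ifP; lia.
have [h|h] := leqP (p %% L) n; have [h'|h'] := leqP (p %% L).+1 n.
- by apply: Or32; lia.
- by apply: Or33; lia.
- by lia.
- by apply: Or31; lia.
Qed.

(** The walk comes straight back to a level only at the far end, since it makes
    two steps on level 0. *)
Lemma zig_turn p : zig p.+2 = zig p -> zig p.+1 = n.
Proof.
have := ltn_pmod p (isT : 0 < L); rewrite /zig !modn_succ //.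
move: (p %% L) => q; case: (eqVneq q.+1 L) => [e|ne] lt /=.
  by do 4?[case: ifP]; lia.
by case: (eqVneq q.+2 L) => [e|ne']; rewrite ?leq0n; do 4?[case: ifP]; lia.
Qed.

Lemma zig_inj p q : p < L -> q < L -> zig p = zig q -> zig p.+1 = zig q.+1 -> p = q.
Proof.
move=> pL qL; rewrite /zig !modn_succ // (modn_small pL) (modn_small qL).
by case: (eqVneq p.+1 L) => hp; case: (eqVneq q.+1 L) => hq;
  rewrite ?leq0n; do 4?[case: ifP]; lia.
Qed.

Lemma zigzag_factor k x u f v : zigzag_word k x -> x = u ++ f ++ v ->
  exists p, forall i, i < size f -> nth 0 (map lev f) i = zig (p + i).
Proof.
move=> [[j e] _] ex; exists (size u + j) => i i_f.
rewrite -(nth_factor 0 (map lev u) (map lev v)) ?size_map // -!map_cat -ex e.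
rewrite nth_mkseq; first by rewrite addnAC.
by have := congr1 size e; rewrite size_map size_mkseq => <-;
  rewrite ex !size_cat; lia.
Qed.

(** The only commuting letters that are adjacent in a zigzag word are the two
    tips. *)
Lemma zigzag_swap k u v s t : zigzag_word k (u ++ [:: s, t & v]) -> M s t = 2 ->
  lev s = lev t.
Proof.
move=> zx /commuting_levels[st ts].
have [p pE] := zigzag_factor zx (erefl (u ++ [:: s; t] ++ v)).
have := pE 0 isT; have := pE 1 isT; rewrite /= addn0 addn1 => lt ls.
by move: st ts; rewrite ls lt; case: (zig_succ p) => [->|->|[-> ->]]; rewrite ?eqxx.
Qed.

Lemma zigzag_word_commeq k x y : commeq M x y -> zigzag_word k x ->
  map lev x = map lev y /\ zigzag_word k y.
Proof.
elim=> {x y} [_ _ [u v s t st] zx|x zx|x y z _ IH1 _ IH2 zx]; last 2 first.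
- by [].
- by have [-> zy] := IH1 zx; exact: IH2.
have e : map lev (u ++ [:: s, t & v]) = map lev (u ++ [:: t, s & v]).
  by rewrite !map_cat /= (zigzag_swap zx st).
split=> //; have [[j ej] tx] := zx; split; first by exists j; rewrite -e.
by move=> b; rewrite -(tip_pair_commeq b (commeq_swap u v st)).
Qed.

Lemma rot1_zig k j : rot 1 (mkseq (fun p => zig (p + j)) (k * L))
  = mkseq (fun p => zig (p + j.+1)) (k * L).
Proof.
have : zig (k * L + j) = zig (0 + j) by rewrite addnC zig_period.
case: (k * L) => // K eK.
have -> : mkseq (fun p => zig (p + j)) K.+1
    = zig j :: mkseq (fun p => zig (p + j.+1)) K.
  rewrite /mkseq /=; congr (_ :: _); rewrite (iotaDl 1 0) -map_comp.
  by apply: eq_map => p /=; rewrite add1n addSnnS.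
by rewrite rot1_cons mkseqS -addSnnS eK.
Qed.

Lemma zigzag_word_rot1 k x : zigzag_word k x -> zigzag_word k (rot 1 x).
Proof.
move=> [[j e] tx]; split; last by move=> b; apply: tip_triple_rot1.
by exists j.+1; rewrite map_rot e rot1_zig.
Qed.

(** A factor [s t s] only occurs where the walk turns at the far end, and there
    the edge has label 4; a factor [s t s t] would have to turn twice in a
    row. *)
Lemma zigzag_word_forbidden k u f v :
  forbidden M f -> ~ zigzag_word k (u ++ f ++ v).
Proof.
move=> ff zx; have [p pE] := zigzag_factor zx erefl.
have far (s t : S) : fork_edge s t -> lev s != lev t by rewrite lev_edge; lia.
case: (forbidden_affB ff) pE => [[s ef]|[s [t [st [[ef [sn tn]]|[ef stn]]]]]];
  rewrite ef => pE.
- have := pE 0 isT; have := pE 1 isT; rewrite /= addn0 addn1 => -> ss.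
  have s0 : lev s = 0 by move: ss; have := pE 0 isT; rewrite /= addn0;
    case: (zig_succ p); lia.
  have [b es] : exists b, s = tip b by case: (s) s0 => [b _|//]; exists b.
  have [_ tx] := zx; subst f s.
  apply: (@triple_no_factor _ _ (tip b) (node 1) _ (tip_pair b u)
    [:: tip b; tip b] (tip_pair b v) _ (tx b)) => //; first by left.
  by rewrite tip_pair_factor {2}/tip_pair /= !eqxx ?orbT.
- have := pE 0 isT; have := pE 1 isT; have := pE 2 isT.
  rewrite /= addn0 addn1 addn2 => s2 t1 s1; have : zig p.+2 =
    zig p by rewrite -s1 -s2.
  by move=> /zig_turn tE; move: tn; rewrite t1 tE ltnn.
- have := pE 0 isT; have := pE 1 isT; have := pE 2 isT; have := pE 3 isT.
  rewrite /= addn0 addn1 addn2 addn3 => t3 s2 t1 s1.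
  have /zig_turn tE : zig p.+2 = zig p by rewrite -s1 -s2.
  have /zig_turn sE : zig p.+3 = zig p.+1 by rewrite -t1 -t3.
  by have := far s t st; rewrite t1 s2 tE sE eqxx.
Qed.

Lemma zigzag_cfc_word k x : zigzag_word k x -> cfc_word M x.
Proof.
apply: (@family_cfc_word _ _ (zigzag_word k)).
- by move=> y z yz /(zigzag_word_commeq yz)[].
- exact: zigzag_word_rot1.
- by move=> u f v; apply: zigzag_word_forbidden.
Qed.

(** ** Interleaving the two tips *)

Lemma pow_head k (x y a b : S) w p : 0 < k ->
  [:: x, y & w] = flatten (nseq k [:: a, b & p]) -> x = a /\ y = b.
Proof. by case: k => // k _ []. Qed.

Lemma triple_headE k s a (x y : S) w : s != a ->
  triple_word k s a [:: x, y & w] ->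
  [/\ x = s -> [:: x, y & w] = flatten (nseq k [:: s; a; a]),
      x = a -> y = s -> [:: x, y & w] = flatten (nseq k [:: a; s; a]),
      x = a -> y = a -> [:: x, y & w] = flatten (nseq k [:: a; a; s])
    & x = s -> y = a].
Proof.
have [-> _|k0 sa] := posnP k; first by case.
move/eqP: sa => sa.
by case=> e; have [? ?] := pow_head k0 e; subst x y; split; intros;
  (exact: e || congruence).
Qed.

Lemma tip_pair_node b x : tip_pair b (node 1 :: x) = node 1 :: tip_pair b x.
Proof. by rewrite /tip_pair /filter /= eqxx. Qed.

Lemma tip_pair_tip b c x :
  tip_pair b (tip c :: x) = if c == b then tip c :: tip_pair b x else tip_pair b x.
Proof. by rewrite /tip_pair [LHS]/= -[tip c == tip b]/(c == b) orbF. Qed.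

Local Notation taa k b := (flatten (nseq k [:: tip b; node 1; node 1])).
Local Notation ata k b := (flatten (nseq k [:: node 1; tip b; node 1])).
Local Notation aat k b := (flatten (nseq k [:: node 1; node 1; tip b])).

(** The linear order of the two tips and of the node next to them, in terms of
    the cyclic patterns of each tip with this node. *)
Section Interleave.
Variables (k : nat) (x : seq S).
Hypothesis tx : forall b, tip_triple k b x.

Let low := filter (fun r => lev r <= 1) x.

Let low_lev : map lev low = level_pair 0 x.
Proof.
rewrite /level_pair filter_map; congr map; apply: eq_filter => r /=.
by case: (lev r) => [|[|]].
Qed.

Let low_tip b : tip_pair b x = tip_pair b low.
Proof.
rewrite /tip_pair -filter_predI; apply: eq_filter => r /=.
by case: eqP => [->//|_]; case: eqP => [->|//]; rewrite lev_node.
Qed.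

Let lev0 r : lev r = 0 -> exists b, r = tip b.
Proof. by case: r => [b _|//]; exists b. Qed.

Let lev1 r : lev r = 1 -> r = node 1.
Proof. by move=> r1; apply: lev_inj; rewrite r1 // lev_node. Qed.

Let tx_low b : triple_word k (tip b) (node 1) (tip_pair b low).
Proof. by rewrite -low_tip. Qed.

Let tip_node b : tip b != node 1. Proof. by []. Qed.

Let other c d : d != c -> d = ~~ c.
Proof. by case: c d => [] []. Qed.

Lemma interleave_1001 w : level_pair 0 x = [:: 1, 0, 0, 1 & w] ->
  forall b, tip_pair b x = ata k b.
Proof.
rewrite -low_lev => e; have [r1 [l1 [e1 /lev1 er1 h1]]] := map_eq_cons e.
have [r2 [l2 [e2 /lev0[c er2] h2]]] := map_eq_cons h1.
have [r3 [l3 [e3 /lev0[d er3] h3]]] := map_eq_cons h2.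
have [r4 [l4 [e4 /lev1 er4 _]]] := map_eq_cons h3; subst r1 r2 r3 r4 l1 l2 l3.
have dc : d = ~~ c.
  apply: other; apply/eqP => dc; have := tx_low c.
  rewrite e1 tip_pair_node !tip_pair_tip dc eqxx => /(triple_headE (tip_node c)).
  by case=> _ /(_ erefl erefl) + _ _; case: (k).
move=> b; rewrite low_tip; move: (tx_low b);
  rewrite e1 dc !tip_pair_node !tip_pair_tip.
by rewrite !tip_pair_node; case: b c {e1 dc e h1 h2 h3} =>
  [] [] /= /(triple_headE (tip_node _))[_ ->].
Qed.

Lemma interleave_0011 w : level_pair 0 x = [:: 0, 0, 1, 1 & w] ->
  forall b, tip_pair b x = taa k b.
Proof.
rewrite -low_lev => e; have [r1 [l1 [e1 /lev0[c er1] h1]]] := map_eq_cons e.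
have [r2 [l2 [e2 /lev0[d er2] h2]]] := map_eq_cons h1.
have [r3 [l3 [e3 /lev1 er3 _]]] := map_eq_cons h2; subst r1 r2 r3 l1 l2.
have dc : d = ~~ c.
  apply: other; apply/eqP => dc; have := tx_low c.
  rewrite e1 !tip_pair_tip dc eqxx => /(triple_headE (tip_node c)).
  by case=> _ _ _ /(_ erefl).
move=> b; rewrite low_tip; move: (tx_low b); rewrite e1 dc !tip_pair_tip.
by rewrite !tip_pair_node; case: b c {e1 dc e h1 h2} =>
  [] [] /= /(triple_headE (tip_node _))[->].
Qed.

Lemma interleave_1100 w : level_pair 0 x = [:: 1, 1 & w] ->
  forall b, tip_pair b x = aat k b.
Proof.
rewrite -low_lev => e; have [r1 [l1 [e1 /lev1 er1 h1]]] := map_eq_cons e.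
have [r2 [l2 [e2 /lev1 er2 _]]] := map_eq_cons h1; subst r1 r2 l1.
move=> b; rewrite low_tip; move: (tx_low b); rewrite e1 !tip_pair_node.
by move=> /(triple_headE (tip_node _))[_ _ ->].
Qed.

Lemma interleave_0110 w : level_pair 0 x = [:: 0, 1, 1 & w] ->
  exists c, tip_pair c x = taa k c /\ tip_pair (~~ c) x = aat k (~~ c).
Proof.
rewrite -low_lev => e; have [r1 [l1 [e1 /lev0[c er1] h1]]] := map_eq_cons e.
have [r2 [l2 [e2 /lev1 er2 h2]]] := map_eq_cons h1.
have [r3 [l3 [e3 /lev1 er3 _]]] := map_eq_cons h2; subst r1 r2 r3 l1 l2.
exists c; rewrite !low_tip; move: (tx_low c) (tx_low (~~ c)).
rewrite e1 !tip_pair_tip !tip_pair_node eqxx; case: (c) => /=.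
  by move=> /(triple_headE (tip_node _))[-> // _ _ _] /(triple_headE (tip_node
    _))[_ _ ->].
by move=> /(triple_headE (tip_node _))[-> // _ _ _] /(triple_headE (tip_node
  _))[_ _ ->].
Qed.

Lemma interleave_0101 w : level_pair 0 x = [:: 0, 1, 0, 1 & w] ->
  exists c, tip_pair c x = taa k c /\ tip_pair (~~ c) x = ata k (~~ c).
Proof.
rewrite -low_lev => e; have [r1 [l1 [e1 /lev0[c er1] h1]]] := map_eq_cons e.
have [r2 [l2 [e2 /lev1 er2 h2]]] := map_eq_cons h1.
have [r3 [l3 [e3 /lev0[d er3] h3]]] := map_eq_cons h2; subst r1 r2 r3 l1 l2.
have dc : d = ~~ c.
  apply: other; apply/eqP => dc; have := tx_low c.
  rewrite e1 !(tip_pair_node, tip_pair_tip) dc eqxx => /(triple_headE (tip_node c)).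
  by case=> /(_ erefl) + _ _ _; case: (k).
exists c; rewrite !low_tip; move: (tx_low c) (tx_low (~~ c)).
rewrite e1 !(tip_pair_tip, tip_pair_node) eqxx dc; case: (c) => /=.
  by move=> /(triple_headE (tip_node _))[-> // _ _ _] /(triple_headE (tip_node
    _))[_ ->].
by move=> /(triple_headE (tip_node _))[-> // _ _ _] /(triple_headE (tip_node
  _))[_ ->].
Qed.

Lemma interleave_1010 w : level_pair 0 x = [:: 1, 0, 1 & w] ->
  exists c, tip_pair c x = ata k c /\ tip_pair (~~ c) x = aat k (~~ c).
Proof.
rewrite -low_lev => e; have [r1 [l1 [e1 /lev1 er1 h1]]] := map_eq_cons e.
have [r2 [l2 [e2 /lev0[c er2] h2]]] := map_eq_cons h1.
have [r3 [l3 [e3 /lev1 er3 _]]] := map_eq_cons h2; subst r1 r2 r3 l1 l2.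
exists c; rewrite !low_tip; move: (tx_low c) (tx_low (~~ c)).
rewrite e1 !(tip_pair_tip, tip_pair_node) eqxx; case: (c) => /=.
  by move=> /(triple_headE (tip_node _))[_ ->
    // _ _] /(triple_headE (tip_node _))[_ _ ->].
by move=> /(triple_headE (tip_node _))[_ ->
  // _ _] /(triple_headE (tip_node _))[_ _ ->].
Qed.

End Interleave.

End Families.

Lemma filter_iota_out i a l : (i.+1 < a) || (a + l <= i) ->
  filter (pred2 i i.+1) (iota a l) = [::].
Proof.
move=> out; apply/eqP; rewrite -[_ == _]negbK -has_filter; apply/hasPn => j.
by rewrite mem_iota /=; lia.
Qed.

Lemma filter_iota_in i l : 0 < i -> i < l ->
  filter (pred2 i i.+1) (iota 1 l) = [:: i; i.+1].
Proof.
move=> i0 il.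
have -> : iota 1 l = iota 1 i.-1 ++ [:: i; i.+1] ++ iota i.+2 (l - i.+1).
  have -> : l = i.-1 + (2 + (l - i.+1)) by lia.
  rewrite !iotaD add1n prednK // addn2; congr (_ ++ (_ ++ iota _ _)); lia.
rewrite !filter_cat !filter_iota_out; try lia.
by rewrite /= !eqxx orbT.
Qed.

Lemma filter_iota_last i : 0 < i -> filter (pred2 i i.+1) (iota 1 i) = [:: i].
Proof.
case: i => // i _; have -> : iota 1 i.+1 = iota 1 i ++ [:: i.+1].
  by rewrite -[[:: i.+1]]/(iota (1 + i) 1) -iotaD addn1.
by rewrite filter_cat filter_iota_out /= ?eqxx //; lia.
Qed.

Lemma filter_iota_first l : 0 < l -> filter (pred2 0 1) (iota 1 l) = [:: 1].
Proof. by case: l => //= l _; rewrite filter_iota_out. Qed.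

Section Representatives.
Variable m : nat.
Local Notation n := m.+2.
Local Notation S := (fork n).
Local Notation M := (affB_matrix n).
Local Notation lev := (@lev m).
Local Notation node := (@node m).
Local Notation tip := (@tip m).
Local Notation N := m.+1.
Implicit Types (s t r : S) (x y : seq S).
Local Notation level_pair := (@level_pair m).
Local Notation tip_pair := (@tip_pair m).
Local Notation L := (2 * n).+1.
Local Notation tip_triple k b x := (triple_word k (tip b) (node 1) (tip_pair b x)).
Local Notation taa k b := (flatten (nseq k [:: tip b; node 1; node 1])).
Local Notation ata k b := (flatten (nseq k [:: node 1; tip b; node 1])).
Local Notation aat k b := (flatten (nseq k [:: node 1; node 1; tip b])).

Lemma tip_pair_pow c k x :
  tip_pair c (flatten (nseq k x)) = flatten (nseq k (tip_pair c x)).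
Proof. exact: filter_pow. Qed.

Lemma level_pair_pow i k x :
  level_pair i (flatten (nseq k x)) = flatten (nseq k (level_pair i x)).
Proof. by rewrite /level_pair map_pow filter_pow. Qed.

(** ** The zigzag classes *)

(** One period of the zigzag walk; [b] is the tip that is visited first. *)
Definition tour b : seq S :=
  rev (map node (iota 1 n)) ++ [:: tip b; tip (~~ b)] ++ map node (iota 1 N).

Definition tour_levels : seq nat := rev (iota 1 n) ++ [:: 0; 0] ++ iota 1 N.

Lemma map_lev_nodes l : l <= n -> map lev (map node (iota 1 l)) = iota 1 l.
Proof.
move=> ln; rewrite -map_comp -[RHS]map_id; apply/eq_in_map => i.
by rewrite mem_iota => il /=; apply: lev_node; lia.
Qed.

Lemma map_lev_tour b : map lev (tour b) = tour_levels.
Proof. by rewrite /tour !map_cat map_rev !map_lev_nodes. Qed.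

Lemma size_tour_levels : size tour_levels = L.
Proof. by rewrite /tour_levels !size_cat size_rev !size_iota /=; lia. Qed.

Lemma tour_levels_zig : tour_levels = mkseq (@zig m) L.
Proof.
apply: (@eq_from_nth _ 0); rewrite size_tour_levels ?size_mkseq // => i iL.
rewrite nth_mkseq // /zig modn_small // /tour_levels nth_cat size_rev size_iota.
have [i_n|n_i] := ltnP i n.
  by rewrite nth_rev ?size_iota // nth_iota; [rewrite leq_eqVlt i_n orbT|]; lia.
have [d ei] : exists d, i = n + d by exists (i - n); lia.
rewrite ei {n_i} in iL *; rewrite addKn; case: d {ei} iL => [|[|d]] iL;
  rewrite ?addn0 ?leqnn ?subnn //=.
  by rewrite addn1 ltnn subnn.
rewrite -[1 :: iota 2 m]/(iota 1 N) nth_iota; last by lia.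
by rewrite ifF; lia.
Qed.

Lemma map_lev_pow_tour k b :
  map lev (flatten (nseq k (tour b))) = mkseq (fun p => zig m (p + 0)) (k * L).
Proof.
rewrite map_pow map_lev_tour (pow_mkseq 0) size_tour_levels.
apply: eq_map => p; rewrite addn0 tour_levels_zig nth_mkseq ?zig_mod //.
exact: ltn_pmod.
Qed.

Lemma level_pair_tour i b : i < N -> level_pair i (tour b) = [:: i.+1; i; i; i.+1].
Proof.
move=> iN; rewrite /level_pair map_lev_tour /tour_levels !filter_cat filter_rev.
case: i iN => [|i] iN; first by rewrite !filter_iota_first.
have [iN1|iN1] := eqVneq i.+2 N.
  by rewrite -iN1 !filter_iota_in //; lia.
by rewrite !filter_iota_in //; lia.
Qed.

Lemma level_pair_tour_top b : level_pair N (tour b) = [:: n; N; N].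
Proof.
rewrite /level_pair map_lev_tour /tour_levels !filter_cat filter_rev.
by rewrite filter_iota_in // filter_iota_last.
Qed.

Lemma tip_pair_nodes c l : 0 < l <= n ->
  tip_pair c (map node (iota 1 l)) = [:: node 1].
Proof.
case: l => // l ln; rewrite [map _ _]/= tip_pair_node /tip_pair; congr (_ :: _).
apply/eqP; rewrite -[_ == _]negbK -has_filter; apply/hasPn => r /mapP[i].
rewrite mem_iota => il ->; rewrite /= -[X in ~~ X]/(node i == node 1).
apply/eqP => /(congr1 lev); rewrite !lev_node; lia.
Qed.

Lemma tip_pair_tour c b : tip_pair c (tour b) = [:: node 1; tip c; node 1].
Proof.
rewrite /tour tip_pair_factor.
have -> : tip_pair c (rev (map node (iota 1 n)))
    = rev (tip_pair c (map node (iota 1 n))) by rewrite /tip_pair filter_rev.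
rewrite !tip_pair_nodes ?leqnn ?ltnS ?leqnSn // !tip_pair_tip.
by case: b c => [] [].
Qed.

Lemma tour_zigzag_word k b : zigzag_word k (flatten (nseq k (tour b))).
Proof.
split; first by exists 0; apply: map_lev_pow_tour.
by move=> c; rewrite tip_pair_pow tip_pair_tour; apply: Or32.
Qed.

Lemma zigzag_start_word k x : 0 < k -> zigzag_start k x -> zigzag_word k x.
Proof.
move=> k0 [top low tx]; have x0 := low 0 isT.
have tipx c : tip_pair c x = ata k c.
  by case: (k) k0 x0 tx => // k' _ x0 tx; rewrite (interleave_1001 tx x0).
have xy : commeq M x (flatten (nseq k (tour true))).
  apply: commeq_of_pairs => [i /andP[_ i_n]|b]; last first.
    by rewrite tipx tip_pair_pow tip_pair_tour.
  rewrite level_pair_pow.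
  have [iN|iN] := ltnP i N; first by rewrite low // level_pair_tour.
  by rewrite (_ : i = N) ?level_pair_tour_top //; lia.
by have [] := zigzag_word_commeq (commeq_sym xy) (tour_zigzag_word k true).
Qed.

Lemma rot_pow_tour k j b : 0 < k -> j <= L ->
  rot j (flatten (nseq k (tour b))) = flatten (nseq k (rot j (tour b))).
Proof.
move=> k0; have sz : size (tour b) = L.
  by rewrite -(size_map lev) map_lev_tour size_tour_levels.
elim: j => [|j IH] jL; first by rewrite !rot0.
rewrite rotS ?size_pow ?sz; last by apply: leq_trans jL _; apply: leq_pmull.
rewrite IH; last exact: ltnW.
rewrite [in RHS]rotS ?sz //; case: (rot j (tour b)) => [|r x];
  last by rewrite rot1_pow rot1_cons.
by rewrite -[rot 1 [::]]/[::]; elim: (k).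
Qed.

Lemma map_lev_rot_tour k j b : 0 < k -> j <= L ->
  map lev (rot j (flatten (nseq k (tour b)))) = mkseq (fun p =>
    zig m (p + j)) (k * L).
Proof.
move=> k0; rewrite map_rot map_lev_pow_tour; elim: j => [|j IH] jL;
  first by rewrite rot0.
rewrite rotS ?size_mkseq; last by apply: leq_trans jL _; apply: leq_pmull.
by rewrite IH ?rot1_zig // ltnW.
Qed.

Lemma low_rot_tour j : j < L -> filter (pred2 0 1) (rot j tour_levels) =
  if j == n then [:: 0; 0; 1; 1] else if j == n.+1 then [:: 0; 1; 1; 0] else
  if j == n.+2 then [:: 1; 1; 0; 0] else [:: 1; 0; 0; 1].
Proof.
pose A := rev (iota 2 N); pose B := iota 2 m; pose p := pred2 0 1.
have eT : tour_levels = A ++ [:: 1; 0; 0; 1] ++ B.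
  by rewrite /tour_levels -[iota 1 n]/(1 :: iota 2 N) rev_cons cat_rcons.
have fA : filter p A = [::] by rewrite filter_rev filter_iota_out.
have fB : filter p B = [::] by rewrite filter_iota_out.
have sA : size A = N by rewrite size_rev size_iota.
have cut C i : filter p C = [::] -> filter p (take i C) =
  [::] /\ filter p (drop i C) = [::].
  by rewrite -{1}(cat_take_drop i C) filter_cat; case: filter => //= ->.
have rotE u v : tour_levels = u ++ v -> size u = j ->
    filter p (rot j tour_levels) = filter p v ++ filter p u.
  by move=> -> <-; rewrite rot_size_cat filter_cat.
move=> jL; have [jN|Nj] := leqP j N.
  have [fT fD] := cut A j fA.
  rewrite (rotE (take j A) (drop j A ++ [:: 1; 0; 0; 1] ++ B)).
  - by rewrite !filter_cat fT fD fB !ifF //; lia.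
  - by rewrite catA cat_take_drop.
  - by rewrite size_takel ?sA.
have [d ej] : exists d, j = n + d by exists (j - n); lia.
case: d ej => [|[|[|d]]] ej.
- rewrite (rotE (A ++ [:: 1]) ([:: 0; 0; 1] ++ B)).
  + by rewrite !filter_cat fA fB ifT //; lia.
  + by rewrite eT -!catA.
  + by rewrite size_cat sA ej /=; lia.
- rewrite (rotE (A ++ [:: 1; 0]) ([:: 0; 1] ++ B)).
  + by rewrite !filter_cat fA fB ifF ?ifT //; lia.
  + by rewrite eT -!catA.
  + by rewrite size_cat sA ej /=; lia.
- rewrite (rotE (A ++ [:: 1; 0; 0]) ([:: 1] ++ B)).
  + have [-> [-> ->]] : (j == n) = false /\ (j == n.+1) = false /\ j == n.+2.
      by lia.
    by rewrite !filter_cat fA fB.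
  + by rewrite eT -!catA.
  + by rewrite size_cat sA ej /=; lia.
have [fT fD] := cut B d fB.
rewrite (rotE (A ++ [:: 1; 0; 0; 1] ++ take d B) (drop d B)).
- by rewrite !filter_cat fT fD fA !ifF //; lia.
- by rewrite -!catA cat_take_drop.
- by rewrite !size_cat sA size_takel ?size_iota /=; lia.
Qed.

Lemma level_pair_rot_tour k j b : 0 < k -> j < L ->
  level_pair 0 (rot j (flatten (nseq k (tour b))))
    = flatten (nseq k (filter (pred2 0 1) (rot j tour_levels))).
Proof.
move=> k0 jL; rewrite rot_pow_tour ?(ltnW jL) // level_pair_pow.
by rewrite /level_pair map_rot map_lev_tour.
Qed.

(** After [n + 1] letters, the cut separates the two tips of a period, and
    exchanging them gives another class. *)
Definition zigzag_reps k : seq (seq S) :=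
  [seq rot j (flatten (nseq k (tour true))) | j <- iota 0 L]
    ++ [:: rot n.+1 (flatten (nseq k (tour false)))].

Lemma size_zigzag_reps k : size (zigzag_reps k) = 2 * n.+1.
Proof. by rewrite size_cat size_map size_iota /=; lia. Qed.

Lemma rot_tour_zigzag_word k j b : zigzag_word k (rot j (flatten (nseq k (tour b)))).
Proof. by apply: rot1_ind => [y|];
  [apply: zigzag_word_rot1|apply: tour_zigzag_word]. Qed.

Lemma zigzag_rep_word k y : y \in zigzag_reps k -> zigzag_word k y.
Proof.
rewrite mem_cat => /orP[/mapP[j _ ->]|]; first exact: rot_tour_zigzag_word.
by rewrite inE => /eqP ->; apply: rot_tour_zigzag_word.
Qed.

(** The cut between the two tips leaves at the front the tip that was visited
    second. *)
Lemma first_tip k b : 0 < k ->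
  tip_pair (~~ b) (rot n.+1 (flatten (nseq k (tour b)))) = taa k (~~ b) /\
  tip_pair b (rot n.+1 (flatten (nseq k (tour b)))) = aat k b.
Proof.
move=> k0; set x := rot _ _.
have tx : forall c, tip_triple k c x by case: (rot_tour_zigzag_word k n.+1 b).
have n1L : n.+1 < L by lia.
have := level_pair_rot_tour b k0 n1L; rewrite -/x low_rot_tour // eqxx ifF;
  last by lia.
have [y ex] : exists y, x = tip (~~ b) :: y.
  rewrite /x rot_pow_tour //; last by lia.
  have -> : tour b = (rev (map node (iota 1 n)) ++ [:: tip b])
      ++ tip (~~ b) :: map node (iota 1 N) by rewrite -catA.
  have sz : size (rev (map node (iota 1 n)) ++ [:: tip b]) = n.+1.
    by rewrite size_cat size_rev size_map size_iota addn1.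
  by rewrite -{1}sz rot_size_cat; case: (k) k0 => // k' _; eexists;
    rewrite flatten_nseqS.
case: (k) k0 tx => // k' _ tx low; have [c [tc tc']] := interleave_0110 tx low.
have [cE|cb] := eqVneq c (~~ b); first by rewrite cE negbK in tc tc'.
have {}cb : ~~ b = ~~ c by case: b c cb {ex tc tc' tx low n1L x} => [] [].
by move: tc'; rewrite -cb ex tip_pair_tip eqxx.
Qed.

Lemma zigzag_reps_complete k x : 0 < k -> zigzag_word k x ->
  exists2 y, y \in zigzag_reps k & commeq M x y.
Proof.
move=> k0 zx; have [[j0 ej0] tx] := zx; pose j := j0 %% L.
have jL : j < L by apply: ltn_pmod.
have ej : map lev x = mkseq (fun p => zig m (p + j)) (k * L).
  by rewrite ej0; apply: eq_map => p; rewrite -[in RHS]zig_mod modnDmr zig_mod.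
have same b : (forall c, tip_pair c x =
  tip_pair c (rot j (flatten (nseq k (tour b))))) ->
    commeq M x (rot j (flatten (nseq k (tour b)))).
  move=> tE; apply: commeq_of_pairs => [i _|//].
  by rewrite /level_pair ej map_lev_rot_tour // ltnW.
have low b : level_pair 0 x = level_pair 0 (rot j (flatten (nseq k (tour b)))).
  by rewrite /level_pair ej map_lev_rot_tour // ltnW.
have ty b : forall c, tip_triple k c (rot j (flatten (nseq k (tour b)))).
  by case: (rot_tour_zigzag_word k j b).
have in_reps : rot j (flatten (nseq k (tour true))) \in zigzag_reps k.
  by rewrite mem_cat; apply/orP; left; apply/mapP; exists j; rewrite ?mem_iota.
have := level_pair_rot_tour true k0 jL; rewrite low_rot_tour // -(low true) => lx.
have [jn1|jn1] := eqVneq j n.+1; last first.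
  exists (rot j (flatten (nseq k (tour true)))) => //; apply: same => c.
  have ly := low true; move: lx ly (ty true) tx; rewrite (negPf jn1).
  case: (k) k0 {ej ej0 zx low ty in_reps} => // k' _.
  case: ifP => _; last case: ifP => _; move=> lx; rewrite lx => ly ty tx.
  - by rewrite (interleave_0011 tx lx) (interleave_0011 ty (esym ly)).
  - by rewrite (interleave_1100 tx lx) (interleave_1100 ty (esym ly)).
  - by rewrite (interleave_1001 tx lx) (interleave_1001 ty (esym ly)).
rewrite jn1 eqxx ifF in lx; last by lia.
have lk b : exists w, level_pair 0 x = [:: 0, 1, 1 & w] /\
    level_pair 0 (rot j (flatten (nseq k (tour b)))) = [:: 0, 1, 1 & w].
  by rewrite -low lx; case: (k) k0 => // k' _; eexists; split.
have [c [tc tc']] : exists c, tip_pair c x = taa k c /\ tip_pair (~~ c) x =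
  aat k (~~ c).
  by have [w [lx' _]] := lk true; exact: (interleave_0110 tx lx').
have [w [_ ly]] := lk (~~ c); have [d [td td']] := interleave_0110 (ty (~~ c)) ly.
have := first_tip (~~ c) k0; rewrite -jn1 negbK => -[fc _].
have dc : d = c.
  have [//|dc] := eqVneq d c; move: td'; have -> : ~~ d =
    c by case: d c dc {td fc tc tc' ly lk} => [] [].
  by rewrite fc; case: (k) k0.
rewrite dc in td td'.
have inb b : rot j (flatten (nseq k (tour b))) \in zigzag_reps k.
  by case: b => //; rewrite /zigzag_reps mem_cat mem_seq1 jn1 eqxx orbT.
exists (rot j (flatten (nseq k (tour (~~ c))))); first exact: inb.
apply: same => b; have [->|bc] := eqVneq b c; first by rewrite tc td.
have -> : b = ~~ c by case: b c bc {tc tc' td td' fc dc ly} => [] [].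
by rewrite tc' td'.
Qed.

Lemma zigzag_rep_cfc k y : y \in zigzag_reps k -> cfc_word M y.
Proof. by move=> /zigzag_rep_word; apply: zigzag_cfc_word. Qed.

Lemma rot_tour_inj k j j' b b' : 0 < k -> j < L -> j' < L ->
  commeq M (rot j (flatten (nseq k (tour b)))) (rot j' (flatten (nseq k (tour
    b')))) ->
  j = j'.
Proof.
move=> k0 jL j'L /zigzag_word_commeq -/(_ _ (rot_tour_zigzag_word k j b))[e _].
rewrite (map_lev_rot_tour _ k0 (ltnW jL)) (map_lev_rot_tour _ k0 (ltnW j'L)) in e.
have kL : 1 < k * L by case: (k) k0 => // k' _; rewrite mulSn; lia.
apply: (@zig_inj m) => //.
  by have := congr1 (fun w => nth 0 w 0) e; rewrite !nth_mkseq // ltnW.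
by have := congr1 (fun w => nth 0 w 1) e; rewrite !nth_mkseq.
Qed.

Lemma zigzag_reps_uniq k : 0 < k -> uniq (map (cox_prod M) (zigzag_reps k)).
Proof.
move=> k0; have ord := affB_exact_orders (isT : 1 < n).
have cfc j b := zigzag_cfc_word (rot_tour_zigzag_word k j b).
rewrite map_cat -map_comp cat_uniq; apply/and3P; split=> //.
  rewrite map_inj_in_uniq ?iota_uniq // => j j'; rewrite !mem_iota /= => jL j'L.
  by move=> /(cfc_word_prod_eq ord (cfc j true) (cfc j' true)) /rot_tour_inj; apply.
rewrite has_map has_seq1; apply/mapP => -[j]; rewrite mem_iota => /andP[_ jL].
move=> /(cfc_word_prod_eq ord (cfc n.+1 false) (cfc j true)) e.
have ej : n.+1 = j by apply: (rot_tour_inj k0 _ jL e); lia.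
rewrite -ej in e; have := tip_pair_commeq true e.
have [t1 _] := first_tip false k0; have [_ t2] := first_tip true k0.
by rewrite t2 [tip_pair true _]t1; case: (k) k0.
Qed.

(** ** The alternating classes *)

(** The Coxeter word on the levels for an acyclic orientation of the path: level
    [i] comes before level [i + 1] when [e i] holds. *)
Fixpoint path_word (e : nat -> bool) i : seq nat :=
  if i is i'.+1 then
    if e i' then rcons (path_word e i') i else i :: path_word e i'
  else [:: 0].

Definition half_word e b : seq S :=
  [seq if l == 0 then tip b else node l | l <- path_word e n].

(** Consecutive letters [s_1] are separated by different tips, so a period
    consists of two copies of the Coxeter word, one for each tip. *)
Definition orientation_word e b k : seq S :=
  flatten (nseq k (half_word e b ++ half_word e (~~ b))).

Lemma path_word_le e i : all (fun l => l <= i) (path_word e i).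
Proof.
elim: i => //= i IH; have {}IH : all (fun l => l <= i.+1) (path_word e i).
  by apply: sub_all IH => l; apply: leqW.
by case: (e i); rewrite ?all_rcons /= leqnn.
Qed.

Lemma size_path_word e i : size (path_word e i) = i.+1.
Proof. by elim: i => //= i IH; case: (e i); rewrite ?size_rcons /= IH. Qed.

Lemma filter_path_word e i j : i < j -> filter (pred2 i i.+1) (path_word e j)
  = if e i then [:: i; i.+1] else [:: i.+1; i].
Proof.
have single : filter (pred2 i i.+1) (path_word e i) = [:: i].
  case: i => //= i; have := path_word_le e i => le.
  have out : filter (pred2 i.+1 i.+2) (path_word e i) = [::].
    apply/eqP; rewrite -[_ == _]negbK -has_filter; apply/hasPn => l /(allP le) /=.
    by lia.
  by case: (e i); rewrite ?filter_rcons /= eqxx out.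
elim: j => // j IH; rewrite ltnS leq_eqVlt => /orP[/eqP <-|ij] /=.
  by case: (e i); rewrite ?filter_rcons /= eqxx orbT single.
have -> : filter (pred2 i i.+1) (path_word e j.+1) =
  filter (pred2 i i.+1) (path_word e j).
  by rewrite /=; case: (e j); rewrite ?filter_rcons /= ifF //; lia.
exact: IH.
Qed.

Lemma map_lev_half e b : map lev (half_word e b) = path_word e n.
Proof.
rewrite /half_word -map_comp -[RHS]map_id; apply/eq_in_map =>
  l /(allP (path_word_le e n)) ln.
by rewrite /comp; have [->//|l0] := posnP l; rewrite lev_node ?l0.
Qed.

Lemma size_half e b : size (half_word e b) = n.+1.
Proof. by rewrite size_map size_path_word. Qed.

Lemma level_pair_half e b i : i < n ->
  level_pair i (half_word e b) = if e i then [:: i; i.+1] else [:: i.+1; i].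
Proof. by move=> i_n; rewrite /level_pair map_lev_half filter_path_word. Qed.

Lemma tip_pair_half e b c : tip_pair c (half_word e b) =
  if c == b then (if e 0 then [:: tip b; node 1] else [:: node 1; tip b])
  else [:: node 1].
Proof.
have tip_node (d : bool) : (node 1 == tip d) = false by [].
pose g l := if l == 0 then tip b else node l.
have -> : tip_pair c (half_word e b)
    = tip_pair c (map g (filter (pred2 0 1) (path_word e n))).
  rewrite /tip_pair /half_word !filter_map -filter_predI; congr map.
  apply: eq_in_filter => l /(allP (path_word_le e n)) ln; rewrite /= andbC.
  case: l ln => [|[|l]] // ln; rewrite /= /g; apply/eqP => /(congr1 lev).
  by rewrite !lev_node //; lia.
rewrite filter_path_word // (eq_sym c); case: (e 0).
  by rewrite -[map g _]/[:: tip b; node 1] tip_pair_tip tip_pair_node.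
rewrite -[map g _]/[:: node 1; tip b] tip_pair_node tip_pair_tip.
by case: (b == c).
Qed.

Lemma pow_double (T : Type) k (w : seq T) :
  flatten (nseq k (w ++ w)) = flatten (nseq (2 * k) w).
Proof. by elim: k => // k IHk; rewrite mulnS /= IHk catA. Qed.

Lemma size_orientation_word e b k : size (orientation_word e b k) = k * (2 * n.+1).
Proof. by rewrite size_pow size_cat !size_half mul2n addnn. Qed.

Lemma level_pair_orientation e b k i : i < n ->
  level_pair i (orientation_word e b k)
    = flatten (nseq (2 * k) (if e i then [:: i; i.+1] else [:: i.+1; i])).
Proof.
move=> i_n; rewrite level_pair_pow -pow_double; congr (flatten (nseq _ _)).
by rewrite {1}/level_pair map_cat filter_cat -!/(level_pair i _) !level_pair_half.
Qed.

Lemma tip_pair_orientation e b k c : tip_pair c (orientation_word e b k) =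
  if c == b then (if e 0 then taa k c else ata k c)
  else (if e 0 then ata k c else aat k c).
Proof.
rewrite tip_pair_pow {1}/tip_pair filter_cat -!/(tip_pair c _) !tip_pair_half.
by case: c b (e 0) => [] [] [].
Qed.

Lemma orientation_word_alternating e b k : alternating_word k (orientation_word
  e b k).
Proof.
split=> [i i_n|c]; rewrite ?level_pair_orientation // ?tip_pair_orientation.
  by case: (e i); [left|right].
by case: eqP => _; case: (e 0); [apply: Or31|apply: Or32|apply: Or32|apply: Or33].
Qed.

Lemma orientation_complete k x : 0 < k -> alternating_word k x ->
  exists e b, forall e', (forall i, i < n -> e' i = e i) ->
    commeq M x (orientation_word e' b k).
Proof.
move=> k0 [lx tx].
pose e i := level_pair i x == flatten (nseq (2 * k) [:: i; i.+1]).
have lxE i : i < n -> level_pair i x =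
    flatten (nseq (2 * k) (if e i then [:: i; i.+1] else [:: i.+1; i])).
  by move=> i_n; rewrite /e; case: eqP => [//|ne]; case: (lx i i_n) => // /ne.
have [b bE] : exists b, forall c, tip_pair c x = if c == b
    then (if e 0 then taa k c else ata k c) else (if e 0 then ata k c else aat k c).
  have := lxE 0 isT; case: (k) k0 tx => // k' _ tx; case: (e 0); rewrite mulnS => x0.
    have [c [tc tc']] := interleave_0101 tx x0; exists c => d.
    by have [->//|dc] := eqVneq d c; have -> : d =
      ~~ c by case: d c dc {tc tc'} => [] [].
  have [c [tc tc']] := interleave_1010 tx x0; exists c => d.
  by have [->//|dc] := eqVneq d c; have -> : d =
    ~~ c by case: d c dc {tc tc'} => [] [].
exists e, b => e' ee'; apply: commeq_of_pairs => [i /andP[_ i_n]|c].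
  by rewrite level_pair_orientation // lxE // ee'.
by rewrite tip_pair_orientation bE ee'.
Qed.

Lemma orientation_inj k e b e' b' : 0 < k ->
  commeq M (orientation_word e b k) (orientation_word e' b' k) ->
  b = b' /\ forall i, i < n -> e i = e' i.
Proof.
move=> k0 ww'.
have ee' i : i < n -> e i = e' i.
  move=> i_n; have := level_pair_commeq i ww'; rewrite !level_pair_orientation //.
  by case: (k) k0 => // k' _; case: (e i) (e' i) => [] [] // [] ; lia.
split=> //; have := tip_pair_commeq true ww'; rewrite !tip_pair_orientation ee' //.
by case: (k) k0 => // k' _; case: b b' (e' 0) {ww'} => [] [] [] // [].
Qed.

Definition alternating_reps k : seq (seq S) :=
  [seq orientation_word (fun i => f (inord i)) (f ord_max) k
    | f : {ffun 'I_n.+1 -> bool} <- enum {: {ffun 'I_n.+1 -> bool}}].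

Lemma size_alternating_reps k : size (alternating_reps k) = 2 ^ n.+1.
Proof. by rewrite size_map -cardE card_ffun card_bool card_ord. Qed.

Lemma alternating_rep_word k y : y \in alternating_reps k -> alternating_word k y.
Proof. by move=> /mapP[f _ ->]; apply: orientation_word_alternating. Qed.

Lemma alternating_reps_complete k x : 0 < k -> alternating_word k x ->
  exists2 y, y \in alternating_reps k & commeq M x y.
Proof.
move=> k0 /(orientation_complete k0)[e [b xE]].
pose f := [ffun i : 'I_n.+1 => if i < n then e i else b].
have f_max : f ord_max = b by rewrite ffunE ltnn.
exists (orientation_word (fun i => f (inord i)) (f ord_max) k).
  by apply/mapP; exists f => //; rewrite mem_enum.
rewrite f_max; apply: xE => i i_n; rewrite ffunE inordK ?i_n //.
exact: ltnW.
Qed.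

Lemma alternating_reps_uniq k : 0 < k -> uniq (map (cox_prod M) (alternating_reps k)).
Proof.
move=> k0; have ord := affB_exact_orders (isT : 1 < n).
rewrite -map_comp map_inj_uniq ?enum_uniq // => f g.
have cfc e b := alternating_cfc_word (orientation_word_alternating e b k).
move=> /(cfc_word_prod_eq ord (cfc _ _) (cfc _ _)) /(orientation_inj k0)[fg fgi].
apply/ffunP => i; have [i_n|] := ltnP i n; first by have := fgi i i_n;
  rewrite inord_val.
by move=> n_i; have -> : i = ord_max by apply/ord_inj/eqP;
  rewrite eqn_leq n_i -ltnS ltn_ord.
Qed.

End Representatives.

(** * Counting *)

Lemma class_representatives (T : eqType) (R : T -> T -> Prop) (s : seq T) :
    (forall x, R x x) -> (forall x y, R x y -> R y x) ->
  exists l, [/\ uniq l, {subset l <= s},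
    forall x y, x \in l -> y \in l -> R x y -> x = y
    & forall x, x \in s -> exists2 y, y \in l & R x y].
Proof.
move=> Rxx Rsym; elim: s => [|x s [l [ul ls lR lc]]]; first by exists [::].
have sub z : z \in l -> z \in x :: s by move=> /ls zs; rewrite inE zs orbT.
have [[y yl xy]|nR] := pselect (exists2 y, y \in l & R x y).
  exists l; split=> // z; rewrite inE => /orP[/eqP ->|/lc//]; by exists y.
exists (x :: l); split=> [|z|y z|z].
- by rewrite /= ul andbT; apply/negP => xl; apply: nR; exists x.
- by rewrite inE => /orP[/eqP ->|/sub//]; rewrite mem_head.
- rewrite !inE => /orP[/eqP ->|yl] /orP[/eqP ->|zl] // yz.
  + by case: nR; exists z.
  + by case: nR; exists y => //; apply: Rsym.
  + exact: lR yz.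
- rewrite inE => /orP[/eqP ->|/lc[y yl zy]]; first by exists x; rewrite ?mem_head.
  by exists y; rewrite ?inE ?yl ?orbT.
Qed.

Lemma card_CFC (S : finType) (M : coxMatrix S) k (l : seq (seq S)) :
    exact_orders M -> (forall x, x \in l -> size x = k /\ cfc_word M x) ->
    uniq (map (cox_prod M) l) ->
    (forall x, size x = k -> cfc_word M x -> exists2 y, y \in l & commeq M x y) ->
  #|` fset_set (CFC_of_length M k)| = size l.
Proof.
move=> ord lk ul lc.
have -> : CFC_of_length M k = [set` [fset w in map (cox_prod M) l]%fset]%classic.
  apply/seteqP; split=> w /=; rewrite in_fset /=.
    move=> /(CFC_of_lengthP _ _ ord)[x [xk cx <-]]; have [y yl xy] := lc x xk cx.
    by rewrite (commeq_prod xy); apply: map_f.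
  move=> /mapP[x xl ->]; apply/(CFC_of_lengthP _ _ ord).
  by have [xk cx] := lk x xl; exists x.
by rewrite set_fsetK card_fseq undup_id // size_map.
Qed.

Section Count.
Variable m : nat.
Local Notation n := m.+2.
Local Notation S := (fork n).
Local Notation B := (affB_matrix n).
Local Notation D := (D_matrix n).

Lemma size_uniq_fork (x : seq S) : uniq x -> size x <= n.+2.
Proof.
move=> /card_uniqP <-; apply: leq_trans (max_card _) _.
by rewrite card_sum card_bool card_ord.
Qed.

(** Both groups have the same pairs of commuting generators. *)
Lemma commeq_D_B (x y : seq S) : commeq D x y <-> commeq B x y.
Proof.
have MDB s t : (D s t != 2) = (B s t != 2) by rewrite D_commute affB_commute.
by split=> xy; apply: commeq_filterP => s t st; apply: commeq_filter xy;
  rewrite ?MDB // -MDB.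
Qed.

Lemma uniq_representatives k : exists l : seq (seq S),
  [/\ forall x, x \in l -> size x = k /\ uniq x, uniq l,
      forall x y, x \in l -> y \in l -> commeq B x y -> x = y
    & forall x, size x = k -> uniq x -> exists2 y, y \in l & commeq B x y].
Proof.
pose s := [seq x <- map val (enum {: k.-tuple S}) | uniq x].
have [l [ul ls lR lc]] := @class_representatives _ (commeq B) s
  (@commeq_refl _ B) (@commeq_sym _ B).
exists l; split=> // [x /ls|x xk ux].
  by rewrite mem_filter => /andP[ux /mapP[t _ xt]]; split=> //; rewrite xt size_tuple.
apply: lc; rewrite mem_filter ux; apply/mapP.
have xk' : size x == k by apply/eqP.
by exists (Tuple xk'); rewrite ?mem_enum.
Qed.

Lemma count_pow (T : eqType) (p : pred T) k w :
  count p (flatten (nseq k w)) = k * count p w.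
Proof. by elim: k => // k IHk; rewrite mulSn /= count_cat IHk. Qed.

(** The last node of the chain occurs as often as its neighbour in an
    alternating word, but half as often in a zigzag word. *)
Lemma alternating_zigzag_disjoint k k' (x y : seq S) : 0 < k' ->
  x \in alternating_reps m k -> y \in zigzag_reps m k' -> ~ commeq B x y.
Proof.
move=> k0 /alternating_rep_word[lx _] y_rep xy.
have ec p : count p (level_pair m.+1 x) = count p (level_pair m.+1 y).
  by rewrite (level_pair_commeq m.+1 xy).
have cy i : count_mem i (level_pair m.+1 y) = k' * count_mem i [:: n; m.+1; m.+1].
  have rotE j b : count_mem i (level_pair m.+1 (rot j (flatten (nseq k' (tour m b)))))
      = k' * count_mem i [:: n; m.+1; m.+1].
    rewrite -(level_pair_tour_top m b) -count_pow -level_pair_pow /level_pair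
      !count_filter.
    by rewrite map_rot count_rot.
  by move: y_rep; rewrite mem_cat => /orP[/mapP[j _ ->]|]; rewrite ?inE;
    [|move=> /eqP ->];
    apply: rotE.
have cx : count_mem n (level_pair m.+1 x) = count_mem m.+1 (level_pair m.+1 x).
  case: (lx m.+1 (ltnSn _)) => ->; rewrite !count_pow /= !eqxx; lia.
move: cx; rewrite !ec !cy /= !eqxx; lia.
Qed.

Definition when (b : bool) (T : Type) (l : seq T) : seq T := if b then l else [::].

Lemma mem_when b (T : eqType) (l : seq T) x : (x \in when b l) = b && (x \in l).
Proof. by case: b. Qed.

Lemma size_alternating_rep k y : y \in alternating_reps m k -> size y =
  k * (2 * n.+1).
Proof. by move=> /mapP[f _ ->]; apply: size_orientation_word. Qed.

Lemma size_zigzag_rep k y : y \in zigzag_reps m k -> size y = k * (2 * n).+1.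
Proof.
move=> /zigzag_rep_word[[j e] _].
by have := congr1 size e; rewrite size_map size_mkseq.
Qed.

Lemma affB_cfc_cases x : cfc_word B x -> uniq x \/ exists2 k, 0 < k &
  (exists2 y, y \in alternating_reps m k & commeq B x y) \/
  (exists2 y, y \in zigzag_reps m k & commeq B x y).
Proof.
move=> cx; have bf := cx x (commeq_refl B x).
have [ux|nux] := boolP (uniq x); [by left|right].
have [k k0 [ax|[j zx]]] := affB_families bf nux; exists k => //.
  by left; apply: alternating_reps_complete.
right; apply: zigzag_reps_complete => //.
have [i <-] := rot_back j x; apply: rot1_ind => [y|].
  exact: zigzag_word_rot1.
exact: zigzag_start_word.
Qed.

(** A word without repetition has at most [n + 2] letters, fewer than the words
    of the other two families, which are disjoint by
    [alternating_zigzag_disjoint]. *)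
Lemma card_CFC_affB k : #|` fset_set (CFC_of_length B k)| =
  #|` fset_set (CFC_of_length D k)|
  + (if (0 < k) && (2 * n.+1 %| k) then 2 ^ n.+1 else 0)
  + (if (0 < k) && ((2 * n).+1 %| k) then 2 * n.+1 else 0).
Proof.
have ordB := affB_exact_orders (isT : 1 < n); have ordD := @D_exact_orders n.
have [l [lk ul lR lc]] := uniq_representatives k.
have uniq_prod (M : coxMatrix S) : exact_orders M ->
    (forall x y, commeq M x y -> commeq B x y) -> uniq (map (cox_prod M) l).
  move=> ordM MB; rewrite map_inj_in_uniq // => x y xl yl.
  have [[_ ux] [_ uy]] := (lk x xl, lk y yl).
  move=> /(cfc_word_prod_eq ordM (uniq_cfc_word ux) (uniq_cfc_word uy)) /MB.
  exact: lR.
have -> : #|` fset_set (CFC_of_length D k)| = size l.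
  apply: card_CFC => // [x /lk[xk ux]||x xk cx].
  - by split=> //; apply: uniq_cfc_word.
  - by apply: uniq_prod => // x y /commeq_D_B.
  have ux : uniq x by apply: D_uniq; apply: cx; apply: commeq_refl.
  by have [y yl /commeq_D_B xy] := lc x xk ux; exists y.
pose a := k %/ (2 * n.+1); pose z := k %/ (2 * n).+1.
pose bA := (0 < k) && (2 * n.+1 %| k); pose bZ := (0 < k) && ((2 * n).+1 %| k).
have a0 : bA -> 0 < a by move=> /andP[k0 ak]; rewrite divn_gt0 // dvdn_leq.
have z0 : bZ -> 0 < z by move=> /andP[k0 ak]; rewrite divn_gt0 // dvdn_leq.
have -> : (if bA then 2 ^ n.+1 else 0) = size (when bA (alternating_reps m a)).
  by rewrite /when; case: (bA); rewrite ?size_alternating_reps.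
have -> : (if bZ then 2 * n.+1 else 0) = size (when bZ (zigzag_reps m z)).
  by rewrite /when; case: (bZ); rewrite ?size_zigzag_reps.
rewrite -addnA -!size_cat; apply: card_CFC => // [x||x xk cx].
- rewrite !mem_cat !mem_when => /orP[/lk[xk ux]|/orP[/andP[bA1 xA]|/andP[bZ1 xZ]]].
  + by split=> //; apply: uniq_cfc_word.
  + split; last exact: (alternating_cfc_word (alternating_rep_word xA)).
    by rewrite (size_alternating_rep xA) divnK //; case/andP: bA1.
  + split; last exact: zigzag_rep_cfc xZ.
    by rewrite (size_zigzag_rep xZ) divnK //; case/andP: bZ1.
- have cfcA x : x \in alternating_reps m a -> cfc_word B x.
    by move=> xA; exact: (alternating_cfc_word (alternating_rep_word xA)).
  rewrite !map_cat !cat_uniq uniq_prod //=; apply/and4P; split.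
  + apply/hasPn => w; rewrite mem_cat => wAZ; apply/negP => /mapP[x /lk[xk ux] wx].
    have kn : k <= n.+2 by rewrite -xk size_uniq_fork.
    case/orP: wAZ => /mapP[y]; rewrite mem_when => /andP[/andP[k0 dvd]] _ _.
      by have := dvdn_leq k0 dvd; lia.
    by have := dvdn_leq k0 dvd; lia.
  + by case: (bA) a0 => //= a0; apply: alternating_reps_uniq; apply: a0.
  + apply/hasPn => w /mapP[y]; rewrite mem_when => /andP[bZ1 yZ] wy.
    apply/negP => /mapP[x]; rewrite mem_when => /andP[bA1 xA] wx.
    apply: (alternating_zigzag_disjoint (z0 bZ1) xA yZ).
    apply/(cfc_word_prod_eq ordB (cfcA x xA) (zigzag_rep_cfc yZ)).
    by rewrite -wx -wy.
  + by case: (bZ) z0 => //= z0; apply: zigzag_reps_uniq; apply: z0.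
have [ux|[c c0 [[y yA xy]|[y yZ xy]]]] := affB_cfc_cases cx.
- by have [y yl xy] := lc x xk ux; exists y; rewrite // mem_cat yl.
- have ek : k = c * (2 * n.+1).
    by rewrite -xk (perm_size (commeq_perm xy)) (size_alternating_rep yA).
  exists y => //; rewrite !mem_cat !mem_when.
  have -> : a = c by rewrite /a ek mulnK.
  by rewrite yA /bA ek dvdn_mull // muln_gt0 c0 orbT.
- have ek : k = c * (2 * n).+1.
    by rewrite -xk (perm_size (commeq_perm xy)) (size_zigzag_rep yZ).
  exists y => //; rewrite !mem_cat !mem_when.
  have -> : z = c by rewrite /z ek mulnK.
  by rewrite yZ /bZ ek dvdn_mull // muln_gt0 c0 !orbT.
Qed.

Lemma card_CFC_D_large k : n.+2 < k -> #|` fset_set (CFC_of_length D k)| = 0.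
Proof.
move=> kn; rewrite (@card_CFC _ _ _ [::]) //; first exact: D_exact_orders.
move=> x xk cx; have ux : uniq x by apply: D_uniq; apply: cx; apply: commeq_refl.
by have := size_uniq_fork ux; rewrite xk leqNgt kn.
Qed.

(** The Coxeter elements, products of all the generators, are counted here. *)
Lemma card_CFC_D_top : 0 < #|` fset_set (CFC_of_length D n.+2)|.
Proof.
rewrite cardfs_gt0; apply/fset0Pn; exists (cox_prod D (enum (fork n))).
rewrite in_fset_set; last exact: finite_CFC_of_length.
rewrite inE; apply/(CFC_of_lengthP _ _ (@D_exact_orders n)).
exists (enum (fork n)); split=> //; last by apply/uniq_cfc_word/enum_uniq.
by rewrite -cardE card_sum card_bool card_ord.
Qed.

End Count.

(** * Generating functions *)

Import GRing.Theory.
Local Open Scope ring_scope.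

Section Series.
Variable R : comNzRingType.
Implicit Types a b : fps R.

Lemma fps_X_mul a k : (fps_X R * a) k = if k is k'.+1 then a k' else 0.
Proof.
rewrite -[LHS]/(fps_mul (fps_X R) a k) /fps_mul; case: k => [|k].
  by rewrite big_ord1 /fps_X mul0r.
rewrite big_ord_recl /fps_X mul0r add0r big_ord_recl /= mul1r subSS subn0.
by rewrite big1 ?addr0 // => i _; rewrite mul0r.
Qed.

Lemma fps_Xn_mul N a k :
  (fps_X R ^+ N * a) k = if (N <= k)%N then a (k - N)%N else 0.
Proof.
elim: N k => [|N IH] k; first by rewrite expr0 mul1r subn0.
by rewrite exprS -mulrA fps_X_mul; case: k => [|k] //; rewrite IH.
Qed.

Definition fps_multiples N : fps R := fun k => (N %| k)%N%:R.

Lemma fps_geometric N : (0 < N)%N ->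
  (1 - fps_X R ^+ N)^-1 = fps_multiples N.
Proof.
move=> N0; apply: mulr1_eq; rewrite mulrBl mul1r; apply/funext => k.
rewrite -[LHS]/(fps_multiples N k - (fps_X R ^+ N * fps_multiples N) k).
rewrite fps_Xn_mul /fps_multiples -[RHS]/((k == 0)%N%:R).
have [Nk|kN] := leqP N k.
  rewrite -{1}(subnK Nk) dvdn_addl // subrr.
  by rewrite (_ : (k == 0)%N = false) //; lia.
by rewrite subr0; case: k kN => [|k] kN; rewrite ?dvdn0 // gtnNdvd.
Qed.

Lemma fps_mulrn_coef a c k : (a *+ c) k = a k *+ c.
Proof.
by elim: c => [|c IH]; rewrite ?mulr0n // !mulrS -IH.
Qed.

Lemma fps_multiples_tail N c k : (0 < N)%N ->
  (c%:R / (1 - fps_X R ^+ N) * fps_X R ^+ N) k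
    = (if (0 < k)%N && (N %| k)%N then c else 0)%N%:R.
Proof.
move=> N0; rewrite fps_geometric // mulr_natl mulrC fps_Xn_mul fps_mulrn_coef.
rewrite /fps_multiples; have [Nk|kN] := leqP N k.
  have -> : (N %| k)%N = (N %| k - N)%N by rewrite -{1}(subnK Nk) dvdn_addl.
  by rewrite (leq_trans N0 Nk); case: (N %| _)%N; rewrite ?mul0rn.
by case: k kN => [|k] kN; rewrite ?ltnn // gtnNdvd.
Qed.

End Series.

Local Open Scope nat_scope.

(** An eventual period sends large common multiples of [2 n + 2] and [2 n + 1],
    where both terms contribute, to common multiples again. The index [n + 2] is
    smaller than both numbers, so no multiple of them is congruent to it modulo
    their product, while [d] does not vanish there. *)
Lemma exact_period_of_multiples (a d : nat -> nat) n u v : 2 <= n -> 0 < u -> 0 < v ->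
    (forall k, a k = d k + (if (0 < k) && (2 * n.+1 %| k) then u else 0)
                     + (if (0 < k) && ((2 * n).+1 %| k) then v else 0)) ->
    (forall k, n.+2 < k -> d k = 0) -> 0 < d n.+2 ->
  exact_period_from a (2 * n.+1 * (2 * n).+1) n.+3.
Proof.
move=> n2 u0 v0 aE d0 dn; set p := 2 * n.+1 in aE *; set q := (2 * n).+1 in aE *.
have pq : coprime p q.
  by rewrite (_ : p = q.+1) ?coprimeSn // /p /q mulnS.
have p0 : 0 < p by rewrite /p.
have tail k : n.+2 < k -> a k = (if p %| k then u else 0) + (if q %| k then v else 0).
  by move=> nk; rewrite aE d0 // (leq_trans _ nk).
have P0 : 0 < p * q by rewrite muln_gt0 p0.
have pP : p %| p * q by rewrite dvdn_mulr.
have qP : q %| p * q by rewrite dvdn_mull.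
have per : periodic_from a (p * q) n.+3.
  move=> k nk; rewrite !tail //; last by rewrite (leq_trans nk) ?leq_addr.
  by rewrite !dvdn_addl.
split=> //; first by split=> //; exists n.+3.
  move=> N' [N'0 [L' perL]]; apply: dvdn_leq => //.
  pose K := p * q * (L' + n.+3).
  have LK : L' <= K by apply: leq_trans (leq_pmull _ P0); apply: leq_addr.
  have nK : n.+2 < K by apply: leq_trans (leq_pmull _ P0); apply: leq_addl.
  have pK : p %| K by rewrite /K dvdn_mulr.
  have qK : q %| K by rewrite /K dvdn_mulr.
  have := perL K LK; rewrite !tail //; last by rewrite (leq_trans nK) ?leq_addr.
  rewrite pK qK (dvdn_addr _ pK) (dvdn_addr _ qK) Gauss_dvd //.
  move: u0 v0; clear; case: (p %| N'); case: (q %| N') => //=; lia.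
move=> L' perL; rewrite leqNgt; apply/negP => nL.
have := perL n.+2 nL; rewrite tail; last by lia.
have small r : n.+2 < r -> (r %| n.+2) = false by move=> nr; rewrite gtnNdvd.
rewrite !dvdn_addl // !small; last 2 first.
- by rewrite /q; lia.
- by rewrite /p; lia.
by rewrite aE; lia.
Qed.

Local Open Scope ring_scope.

Theorem corollary3p6 (n : nat) (hn : (2 <= n)%N) :
  CFC_series (affB_matrix n)
    = CFC_series (D_matrix n)
      + (2 ^ n.+1)%N%:R / (1 - 'q ^+ (2 * n.+1)) * 'q ^+ (2 * n.+1)
      + (2 * n.+1)%N%:R / (1 - 'q ^+ (2 * n).+1) * 'q ^+ (2 * n).+1
  /\ exact_period_from (fps_coef (CFC_series (affB_matrix n)))
       (2 * n.+1 * (2 * n).+1) n.+3.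
Proof.
case: n hn => [|[|m]] // _; set n := m.+2; split.
  apply/funext => k.
  rewrite -[RHS]/(CFC_series (D_matrix n) k
    + ((2 ^ n.+1)%N%:R / (1 - 'q ^+ (2 * n.+1)) * 'q ^+ (2 * n.+1)) k
    + ((2 * n.+1)%N%:R / (1 - 'q ^+ (2 * n).+1) * 'q ^+ (2 * n).+1) k).
  rewrite [X in _ + X + _](@fps_multiples_tail int (2 * n.+1) (2 ^ n.+1)%N k isT).
  rewrite [X in _ = _ + X](@fps_multiples_tail int (2 * n).+1 (2 * n.+1)%N k isT).
  by rewrite /CFC_series card_CFC_affB !natrD.
pose a k := #|` fset_set (CFC_of_length (affB_matrix n) k)|.
have [[P0 [L perL]] least per start] : exact_period_from a (2 * n.+1 * (2 *
  n).+1) n.+3.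
  apply: (@exact_period_of_multiples a
    (fun k => #|` fset_set (CFC_of_length (D_matrix n) k)|) n (2 ^ n.+1) (2 *
      n.+1)) => //.
  - by rewrite expn_gt0.
  - exact: card_CFC_affB.
  - exact: card_CFC_D_large.
  - exact: card_CFC_D_top.
have coefE N L' : periodic_from (fps_coef (CFC_series (affB_matrix n))) N L' <->
    periodic_from a N L'.
  by split=> perN k kL; [apply/eqP; rewrite -(Num.Theory.eqr_nat int);
    apply/eqP|congr (_%:R)];
    apply: perN.
split.
- by split=> //; exists L; apply/coefE.
- by move=> N' [N'0 [L' /coefE perN']]; apply: least; split=> //; exists L'.
- exact/coefE.
- by move=> L' /coefE; apply: start.
Qed.
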